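(* Let $(z_n)$ be the sequence in the Hilbert space $H$ described in the context. Assume there exist $c\in\mathbb{N}\setminus\{0\}$ and monotone functions $h:\mathbb{N}\to\mathbb{N}\setminus\{0\}$ and $\ell,L,E:\mathbb{N}\to\mathbb{N}$ such that (1) $\lambda_n\ge \frac{1}{h(n)}$ for all $n\in\mathbb{N}$; (2) $\lambda_n\le\frac1{k+1}$ for all $k\in\mathbb{N}$ and $n\ge \ell(k)$; (3) $\sum_{i=1}^{L(k)}\lambda_i\ge k$ for all $k\in\mathbb{N}$; (4) $\min\{c_n,\delta_n^2\}\ge\frac1c$ for all $n\in\mathbb{N}$; (5) either $\sum_{i=E(k)+1}^{E(k)+n}\|e_i\|\le\frac{1}{k+1}$ for all $k,n\in\mathbb{N}$, or $\frac{\|e_n\|}{\lambda_n}\le\frac1{k+1}$ for all $k\in\mathbb{N}$ and $n\ge E(k)$. Let $D\in\mathbb{N}\setminus\{0\}$ be such that $D\ge\max\{2\|u-p\|,\|z_0-p\|\}$ for some $p\in S$, and let $\mathsf{C}:\mathbb{N}\to\mathbb{N}$ be a monotone function with $c_n\le \mathsf{C}(n)$ for all $n$. Let $d_0,d_1,d_2\in\mathbb{N}\setminus\{0\}$ satisfy $d_0\ge\max\{\|u-q\|,\|z_0-q\|\}$ for some $q\in S$, $d_1\ge\sum_{i=0}^{E(0)}\|e_i\|+1$, and $d_2\ge\max\{\|z_i-y_i\|: i\le E(0)\}$. Then for all $k\in\mathbb{N}$ and every monotone function $f:\mathbb{N}\to\mathbb{N}$, $$\exists n\le\nu(k,f)\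 \forall i,j\in[n,f(n)]\ \left(\|z_i-z_j\|\le\frac1{k+1}\right),$$ where $\nu(k,f)=\max\{\mu(36(k+1)^2-1,\widehat f),\Theta(3k+2)\}$, $\widehat f(m)=f(\max\{m,\Theta(3k+2)\})$, $\Theta(j)=L\left(E(3j+2)+\lceil\ln(3d(j+1))\rceil\right)+1$ with $d=\max\{2d_0+d_1,d_2\}$, and $\mu$ is the functional defined in the context from $c,D,\mathsf{C},h,\ell,L$.
   Context: Conventions: $\mathbb{N}=\{0,1,2,\dots\}$; $[a,b]$ with $a,b\in\mathbb{N}$ is the set of integers $i$ with $a\le i\le b$ (empty if $b<a$); $g^{(j)}$ is the $j$-fold iterate of $g$ ($g^{(0)}=\mathrm{id}$); $g+2$ is the function $n\mapsto g(n)+2$. A function $f:\mathbb{N}\to\mathbb{N}$ is monotone if $f(n)\le f(n+1)$ for all $n$. Setting: $H$ is a real Hilbert space, $\mathsf{A}:H\to2^H$ is a maximal monotone operator with $S:=\mathsf{A}^{-1}(0)\ne\emptyset$, and for $\sigma>0$, $J_\sigma=(I+\sigma\mathsf{A})^{-1}$ is its (single-valued, everywhere defined) resolvent. Given are $u,z_0\in H$, $(e_n)\subset H$, $(c_n)\subset(0,+\infty)$, $(\lambda_n),(\delta_n)\subset(0,1)$, $(\gamma_n)\subset[0,1)$ with $\lambda_n+\gamma_n+\delta_n=1$ for all $n\in\mathbb{N}$. The sequences $(z_n),(y_n)$ are defined by $z_{n+1}=\lambda_nu+\gamma_nz_n+\delta_nJ_{c_n}(z_n)+e_n$ and $y_0=z_0$,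 $y_{n+1}=\lambda_nu+\gamma_ny_n+\delta_nJ_{c_n}(y_n)$. Definition of $\mu(k,f)$ for $k\in\mathbb{N}$ and monotone $f:\mathbb{N}\to\mathbb{N}$ (with $c,D,\mathsf{C},h,\ell,L$ fixed; when $\mu$ is evaluated at other arguments, all auxiliary functions are formed with those arguments in place of $k,f$). For $j,n\in\mathbb{N}$ and $g:\mathbb{N}\to\mathbb{N}$: - $\zeta(j,n)=c(j+1)\mathsf{C}(n)-1$; - $\overline{\sigma}(j,n)=L\left(n+\lceil\ln(12D^2(j+1))\rceil\right)+1$; - $\phi_2(j,n,g)=\max\{n,g^{(4D^2(j+1))}(n)\}$ and $\phi_1(j,n,g)=g(\phi_2(j,n,g))$; - $\widetilde f(n)=f(\overline{\sigma}(k,n))$; - $r_1(n)=12c(n+1)^2-1$; - $r_2(n)=\max\{2(n+1),128D(k+1)^2\}$; - $r_3(n)=\ell\left(\max\{96cD^2(n+1)^2-1,\ 256D^2(k+1)^2-1,\ 16c(r_2(n))^2D^2\}\right)$; - $r_4(n)=3(k+1)\left(\widetilde f(\phi_2(r_1(n),r_3(n),\widetilde f+2))+1\right)$; - $\Phi(n)=\phi_1(r_1(n),r_3(n),\widetilde f+2)$; - $\Xi_1(n)=\zeta\left(2(6D+1)\max\{r_1(n),r_4(n)\}-1,\ \phi_1(r_1(n),r_3(n),\widetilde f+2)\right)$; - $\xi(n)=\zeta\left(\max\{16h(f(n))(k+1)^2(6D+1),\ 4c(r_2(n))^2(6D+1)\},\ f(n)\right)$; - $\Xi_2(n)=\xi(\Phi(n))$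 and $\Xi(n)=\max\{\Xi_1(n),\Xi_2(n)\}$. For $j\in\mathbb{N}$ and monotone $g:\mathbb{N}\to\mathbb{N}$: $\beta(j,g)=24D\left(w_g^{(R)}(0)+1\right)^2$ with $R=4D^4(j+1)^2$ and $w_g(m)=\max\{g(24D(m+1)^2),24D(m+1)^2\}$. With $\overline{k}=32(k+1)^2-1$, $\bar r=r_1(\beta(\overline{k},\Xi))$, $\bar n=r_3(\beta(\overline{k},\Xi))$, $$\mu(k,f)=\max\left\{\overline{\sigma}(k,\phi_2(\bar r,\bar n,\widetilde f+2)),\ \Phi(\beta(\overline{k},\Xi))\right\}.$$ *)

(* Defs.v *)
From mathcomp Require Import all_boot all_order all_algebra.
From mathcomp Require Import all_classical all_reals all_analysis.
Import numFieldNormedType.Exports.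
Import Order.TTheory GRing.Theory Num.Theory.

Set Implicit Arguments.
Unset Strict Implicit.
Unset Printing Implicit Defensive.

Local Open Scope classical_set_scope.
Local Open Scope ring_scope.

Definition nat_monotone (f : nat -> nat) : Prop := forall n, (f n <= f n.+1)%N.

Section Operators.
Variables (R : realType) (H : completeNormedModType R).

(* [H] is a real Hilbert space when its (complete) norm is the one induced by
   the inner product [ip]. *)
Definition induces_norm (ip : {dot H for @idfun R}) : Prop :=
  forall x : H, `|x| ^+ 2 = ip x x.

Implicit Types A B : H -> set H.

Definition monotone_op (ip : {dot H for @idfun R}) A : Prop :=
  forall x y a b, A x a -> A y b -> 0 <= ip (x - y) (a - b).

Definition maximal_monotone (ip : {dot H for @idfun R}) A : Prop :=
  monotone_op ip A /\
  forall B, monotone_op ip B -> (forall x, A x `<=` B x) -> B = A.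

Definition inv_op A : H -> set H := fun y => [set x | A x y].

Definition id_plus (sigma : R) A : H -> set H :=
  fun x => [set x + sigma *: a | a in A x].

Definition zeros A : set H := inv_op A 0.

(* The set-valued operator (I + sigma A)^-1 is everywhere defined and
   single-valued, with value [J sigma]. *)
Definition is_resolvent A (J : R -> H -> H) : Prop :=
  forall sigma : R, 0 < sigma ->
    forall x, inv_op (id_plus sigma A) x = [set J sigma x].

End Operators.

Local Close Scope ring_scope.
Local Open Scope nat_scope.

(* The ceiling of ln m as a natural number; it is only used for m >= 1, where
   the ceiling is nonnegative. *)
Definition ceil_ln (R : realType) (m : nat) : nat :=
  absz (Num.ceil (ln (m%:R : R)%R)).

(* The truncated subtractions [_ - 1] below have a positive minuend as soon as
   c, D and the values of C are positive. *)
Section Functionals.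
Variables (R : realType) (c D : nat) (C h l L : nat -> nat).

Definition zeta (j n : nat) : nat := c * (j + 1) * C n - 1.

Definition sigma_bar (j n : nat) : nat :=
  L (n + ceil_ln R (12 * D ^ 2 * (j + 1))) + 1.

Definition phi2 (j n : nat) (g : nat -> nat) : nat :=
  maxn n (iter (4 * D ^ 2 * (j + 1)) g n).

Definition phi1 (j n : nat) (g : nat -> nat) : nat := g (phi2 j n g).

Definition w (g : nat -> nat) (m : nat) : nat :=
  maxn (g (24 * D * (m + 1) ^ 2)) (24 * D * (m + 1) ^ 2).

Definition beta (j : nat) (g : nat -> nat) : nat :=
  24 * D * (iter (4 * D ^ 4 * (j + 1) ^ 2) (w g) 0 + 1) ^ 2.

Definition r1 (n : nat) : nat := 12 * c * (n + 1) ^ 2 - 1.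

Section Mu.
Variables (k : nat) (f : nat -> nat).

Definition f_tilde (n : nat) : nat := f (sigma_bar k n).

Definition f_tilde2 (n : nat) : nat := f_tilde n + 2.

Definition r2 (n : nat) : nat := maxn (2 * (n + 1)) (128 * D * (k + 1) ^ 2).

Definition r3 (n : nat) : nat :=
  l (maxn (maxn (96 * c * D ^ 2 * (n + 1) ^ 2 - 1)
                (256 * D ^ 2 * (k + 1) ^ 2 - 1))
          (16 * c * r2 n ^ 2 * D ^ 2)).

Definition r4 (n : nat) : nat :=
  3 * (k + 1) * (f_tilde (phi2 (r1 n) (r3 n) f_tilde2) + 1).

Definition Phi (n : nat) : nat := phi1 (r1 n) (r3 n) f_tilde2.

Definition Xi1 (n : nat) : nat :=
  zeta (2 * (6 * D + 1) * maxn (r1 n) (r4 n) - 1)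
       (phi1 (r1 n) (r3 n) f_tilde2).

Definition xi (n : nat) : nat :=
  zeta (maxn (16 * h (f n) * (k + 1) ^ 2 * (6 * D + 1))
             (4 * c * r2 n ^ 2 * (6 * D + 1)))
       (f n).

Definition Xi2 (n : nat) : nat := xi (Phi n).

Definition Xi (n : nat) : nat := maxn (Xi1 n) (Xi2 n).

Definition k_bar : nat := 32 * (k + 1) ^ 2 - 1.

Definition r_bar : nat := r1 (beta k_bar Xi).

Definition n_bar : nat := r3 (beta k_bar Xi).

Definition mu : nat :=
  maxn (sigma_bar k (phi2 r_bar n_bar f_tilde2)) (Phi (beta k_bar Xi)).

End Mu.

Variables (E : nat -> nat) (d0 d1 d2 : nat).

Definition d : nat := maxn (2 * d0 + d1) d2.

Definition Theta (j : nat) : nat :=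
  L (E (3 * j + 2) + ceil_ln R (3 * d * (j + 1))) + 1.

Definition f_hat (k : nat) (f : nat -> nat) (m : nat) : nat :=
  f (maxn m (Theta (3 * k + 2))).

Definition nu (k : nat) (f : nat -> nat) : nat :=
  maxn (mu (36 * (k + 1) ^ 2 - 1) (f_hat k f)) (Theta (3 * k + 2)).

End Functionals.

(* Main.v *)
Require Import Defs.
From mathcomp Require Import all_boot all_order all_algebra.
From mathcomp Require Import all_classical all_reals all_analysis.
From mathcomp Require Import ring lra zify.
Import numFieldNormedType.Exports.
Import Order.TTheory GRing.Theory Num.Theory.

Local Open Scope classical_set_scope.
Local Open Scope ring_scope.

(** The errors are separated from the exact iteration y_n. Resolvents are
    nonexpansive, so w_n := |z_n - y_n| satisfies
    w_(n+1) <= (1 - lam_n) w_n + |e_n|, and the divergence of the series of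
    the lam_n drives w_n below 1/(j+1) from Theta(j) on ([perturbation_rate]).
    It remains to find, within the bound mu, an interval on which all y_i are
    close to one point x ([exact_metastable]); the triangle inequality through
    y_i and x then gives the theorem.

    If the metric projection x of u onto the zeros of A were available, the
    proof would be the classical one: |y_(n+1) - x|^2 is at most
      (1 - lam_n) |y_n - x|^2 + 2 lam_n <u - x, y_(n+1) - x> - |y_n - J y_n|^2/c,
    and <u - x, y - x> <= 0 for every zero y. For an effective bound, x is
    replaced by an almost fixed point of J := J_(1/c) that almost minimizes the
    distance to u among points that are almost fixed only up to 1/(N+1). A
    minimization by finitely many decrements gives such an x with N <= beta,
    and makes x itself as precise as a prescribed function of N, here Xi
    ([approximate_projection]). The recursive inequality survives with an error
    proportional to |x - J_(c_n) x| ([tikhonov_step]), and weak compactness is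
    avoided: it is enough to show that y_i is almost fixed, as this alone gives
    <u - x, y_i - x> <= 1/(32(k+1)^2).

    That y_i is almost fixed is read off the same inequality, which bounds
    |y_i - J y_i|^2/c by the decrease of s_i := |y_i - x|^2 plus terms that are
    small with lam_i. Two cases are distinguished on the interval from r3(N) to
    Phi(N). If s is nonincreasing there, then, being bounded by 4D^2, it
    decreases little on one of the windows obtained by iterating f_tilde + 2;
    every y_i in this window is almost fixed and the recursion pushes s below
    1/(k+1) ([exact_metastable_decreasing]). Otherwise s increases at some
    index; for i beyond Phi(N) the last increase m before i satisfies
    s_i <= s_(m+1), y_m is almost fixed because s_m < s_(m+1), and the
    inequality at m, divided by lam_m >= 1/h(m), bounds s_(m+1)
    ([exact_metastable_increasing]). *)

(** * Real inner products *)

Section InnerProduct.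
Context {R : realType} {H : completeNormedModType R}.
Context {ip : {dot H for @idfun R}} (ip_norm : induces_norm ip).
Implicit Types a b x y : H.

Lemma ipC x y : ip x y = ip y x.
Proof. by rewrite hermC /= expr0 mul1r. Qed.

Lemma ipDl x y v : ip (x + y) v = ip x v + ip y v.
Proof. by rewrite linearDl. Qed.

Lemma ipDr x y v : ip v (x + y) = ip v x + ip v y.
Proof. by rewrite linearD. Qed.

Lemma ipNl x v : ip (- x) v = - ip x v.
Proof. by rewrite linearNl. Qed.

Lemma ipNr x v : ip v (- x) = - ip v x.
Proof. by rewrite linearN. Qed.

Lemma ipZl (t : R) x v : ip (t *: x) v = t * ip x v.
Proof. by rewrite linearZl_LR. Qed.

Lemma ipZr (t : R) x v : ip v (t *: x) = t * ip v x.
Proof. by rewrite linearZ. Qed.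

Definition ipE := (ipDl, ipDr, ipNl, ipNr, ipZl, ipZr).

(** Turns a vector identity into a scalar one, which [ring] decides once the
    inner products are expanded. *)
Lemma ip_ext x y : (forall v, ip v x = ip v y) -> x = y.
Proof.
move=> xy; apply/eqP; rewrite -subr_eq0 -normr_eq0 -sqrf_eq0.
by rewrite ip_norm ipDr ipNr xy subrr.
Qed.

Lemma sqr_normD a b : `|a + b| ^+ 2 = `|a| ^+ 2 + 2 * ip a b + `|b| ^+ 2.
Proof. by rewrite !ip_norm !ipE (ipC b a); ring. Qed.

Lemma sqr_normB a b : `|a - b| ^+ 2 = `|a| ^+ 2 - 2 * ip a b + `|b| ^+ 2.
Proof. by rewrite sqr_normD normrN ipNr mulrN. Qed.

(** Cauchy-Schwarz, read off the triangle inequality for |a + b| by squaring. *)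
Lemma ip_le_norm a b : ip a b <= `|a| * `|b|.
Proof.
have : `|a + b| ^+ 2 <= (`|a| + `|b|) ^+ 2 by rewrite lerXn2r ?nnegrE ?addr_ge0 ?ler_normD.
rewrite sqr_normD; lra.
Qed.

Lemma sqr_norm_comb (s t : R) a b :
  `|s *: a + t *: b| ^+ 2 =
  (s + t) * (s * `|a| ^+ 2 + t * `|b| ^+ 2) - s * t * `|a - b| ^+ 2.
Proof. by rewrite !ip_norm !ipE (ipC b a); ring. Qed.

End InnerProduct.

Ltac vector_ring :=
  match goal with
  | hyp : induces_norm _ |- _ =>
      apply: (ip_ext hyp) => ?; rewrite !ipE; ring
  end.

(** * Resolvents of monotone operators *)

Section Resolvent.
Context {R : realType} {H : completeNormedModType R}.
Context {ip : {dot H for @idfun R}} (ip_norm : induces_norm ip).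
Context {A : H -> set H} (A_mono : monotone_op ip A).
Context {J : R -> H -> H} (J_res : is_resolvent A J).
Implicit Types (s t : R) (x y p : H).

(** The vector (x - J s x)/s is the value of A selected by the resolvent; this
    is how monotonicity of A reaches the resolvents. *)
Lemma resolventP s x : 0 < s -> exists2 a, A (J s x) a & x - J s x = s *: a.
Proof.
move=> s0; have : inv_op (id_plus s A) x (J s x) by rewrite J_res.
by case=> a Aa xE; exists a; rewrite // -[X in X - _]xE addrC addKr.
Qed.

Lemma resolvent_zero s p : 0 < s -> zeros A p -> J s p = p.
Proof.
move=> s0 Ap; have : inv_op (id_plus s A) p p.
  by exists 0; rewrite ?scaler0 ?addr0.
by rewrite J_res //= => ->.
Qed.

Lemma resolvent_firm s x y : 0 < s ->
  0 <= ip (J s x - J s y) ((x - J s x) - (y - J s y)).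
Proof.
move=> s0; have [a Aa ->] := resolventP s x s0; have [b Ab ->] := resolventP s y s0.
by rewrite -scalerBr linearZ /= mulr_ge0 ?(ltW s0)// A_mono.
Qed.

Lemma resolvent_firm_sqr s x y : 0 < s ->
  `|J s x - J s y| ^+ 2 + `|(x - J s x) - (y - J s y)| ^+ 2 <= `|x - y| ^+ 2.
Proof.
move=> s0; have := resolvent_firm s x y s0.
have -> : `|x - y| = `|(J s x - J s y) + ((x - J s x) - (y - J s y))|.
  by congr `|_|; vector_ring.
by rewrite [X in _ -> _ <= X](sqr_normD ip_norm); lra.
Qed.

Lemma resolvent_nonexpansive s x y : 0 < s -> `|J s x - J s y| <= `|x - y|.
Proof.
move=> s0; rewrite -(@ler_pXn2r _ 2) ?nnegrE //.
by apply: le_trans (resolvent_firm_sqr s x y s0); rewrite lerDl sqr_ge0.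
Qed.

Lemma resolvent_dist_zero s x p : 0 < s -> zeros A p -> `|J s x - p| <= `|x - p|.
Proof.
by move=> s0 Ap; rewrite -{1}(resolvent_zero s p) ?resolvent_nonexpansive.
Qed.

Lemma resolvent_displacement_le s x p : 0 < s -> zeros A p -> `|x - J s x| <= `|x - p|.
Proof.
move=> s0 Ap; rewrite -(@ler_pXn2r _ 2) ?nnegrE //.
apply: le_trans (resolvent_firm_sqr s x p s0).
by rewrite (resolvent_zero s p) // subrr subr0 lerDr sqr_ge0.
Qed.

(** With x - J s x = s a and x - J t x = t b, monotonicity of A and
    Cauchy-Schwarz give (s|a| - t|b|)(|a| - |b|) <= 0. As s <= t, both factors
    have a determined sign: s|a| <= t|b| and |b| <= |a|. *)
Lemma resolvent_monotone_param s t x : 0 < s -> s <= t ->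
  `|x - J s x| <= `|x - J t x| /\ s * `|x - J t x| <= t * `|x - J s x|.
Proof.
move=> s0 st; have t0 := lt_le_trans s0 st.
have [a Aa xa] := resolventP s x s0; have [b Ab xb] := resolventP t x t0.
have Jb : J s x - J t x = t *: b - s *: a by rewrite -xa -xb; vector_ring.
have := A_mono _ _ _ _ Aa Ab.
rewrite Jb !ipE (ipC b a) -!ip_norm => mon.
rewrite xa xb !normrZ !gtr0_norm //.
have := ip_le_norm ip_norm a b.
have := normr_ge0 a; have := normr_ge0 b.
set P := `|a| in mon *; set Q := `|b| in mon *.
move: mon; set g := ip a b => mon Q0 P0 gPQ.
have key : (s * P - t * Q) * (P - Q) <= 0 by nra.
have PQ : s * P <= t * Q.
  rewrite leNgt; apply/negP => lt1.
  have : Q < P by rewrite -(ltr_pM2l s0); apply: le_lt_trans lt1; exact: ler_wpM2r.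
  by move=> lt2; move: key; rewrite leNgt mulr_gt0 // subr_gt0.
split=> //; case: (leP Q P) => [QP|PQ'].
  by rewrite mulrCA ler_wpM2l ?(ltW t0)// ler_wpM2l // ltW.
have : s * P < t * Q by apply: le_lt_trans (ler_wpM2r P0 st) _; rewrite ltr_pM2l.
by move=> lt1; move: key; rewrite leNgt nmulr_rgt0 ?subr_lt0 ?PQ' //.
Qed.

(** Since T is nonexpansive, T w is almost as close to x and to y as w is. In a
    Hilbert space the point at distances (nearly) t|x - y| and (1 - t)|x - y| from
    the two ends of a segment is (nearly) unique, so T w is close to w. *)
Lemma convex_almost_fixed (T : H -> H) x y w (eta r t : R) :
  (forall v w, `|T v - T w| <= `|v - w|) ->
  `|x - T x| <= eta -> `|y - T y| <= eta -> `|x - y| <= r -> 0 <= t <= 1 ->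
  w = (1 - t) *: x + t *: y -> `|w - T w| ^+ 2 <= r * eta + eta ^+ 2.
Proof.
move=> Tne xe ye xyr /andP[t0 t1] wE.
have eta0 : 0 <= eta by exact: le_trans xe.
have wx : w - x = t *: (y - x).
  by rewrite wE; vector_ring.
have wy : w - y = (1 - t) *: (x - y).
  by rewrite wE; vector_ring.
have d0 := normr_ge0 (x - y).
have Twx : `|x - T w| <= t * `|x - y| + eta.
  rewrite -[x - T w](subrKA (T x)) addrC (le_trans (ler_normD _ _)) // lerD //.
  by rewrite (le_trans (Tne _ _)) // distrC wx normrZ (ger0_norm t0) distrC.
have Twy : `|y - T w| <= (1 - t) * `|x - y| + eta.
  rewrite -[y - T w](subrKA (T y)) addrC (le_trans (ler_normD _ _)) // lerD //.
  by rewrite (le_trans (Tne _ _)) // distrC wy normrZ ger0_norm ?subr_ge0.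
have -> : w - T w = (1 - t) *: (x - T w) + t *: (y - T w).
  by rewrite {1}wE; vector_ring.
rewrite (sqr_norm_comb ip_norm) subrK mul1r.
have -> : x - T w - (y - T w) = x - y by rewrite opprB addrA subrK.
have s1 : `|x - T w| ^+ 2 <= (t * `|x - y| + eta) ^+ 2.
  by rewrite lerXn2r ?nnegrE ?addr_ge0 ?mulr_ge0.
have s2 : `|y - T w| ^+ 2 <= ((1 - t) * `|x - y| + eta) ^+ 2.
  by rewrite lerXn2r ?nnegrE ?addr_ge0 ?mulr_ge0 ?subr_ge0.
have {}s1 := ler_wpM2l (_ : 0 <= 1 - t) s1.
have {}s2 := ler_wpM2l t0 s2.
have q : 4 * t * (1 - t) * `|x - y| * eta <= r * eta.
  rewrite ler_wpM2r //; apply: le_trans xyr; rewrite ler_piMl //.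
  by have := sqr_ge0 (1 - 2 * t); lra.
have {}s1 := s1 ltac:(by rewrite subr_ge0).
nra.
Qed.
End Resolvent.

(** * Approximate projection onto the almost fixed points *)

(** Going down from level B to level 0: as long as no point is an
    [eps]-minimizer for the next coarser level, [theta] can be lowered by more
    than [eps], which is possible fewer than B times because [theta] starts
    below B eps and stays nonnegative. The point found is in the finer class of
    level i + 1 while it competes with the coarser class of level i. *)
Lemma approximate_minimum {R : realType} {T : Type} (K : nat -> T -> Prop)
    (theta : T -> R) (eps : R) (g : nat -> nat) (B : nat) (x0 : T) :
  (forall n, K n x0) -> (forall x, 0 <= theta x) -> theta x0 < B%:R * eps ->
  exists i x, [/\ (i < B)%N, K (iter i.+1 g 0%N) x &
    forall y, K (iter i g 0%N) y -> theta x <= theta y + eps].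
Proof.
move=> Kx0 theta_ge0 theta_lt; apply: contrapT => no_min.
have descent j : (j <= B)%N ->
    exists2 y, K (iter (B - j) g 0%N) y & theta y <= theta x0 - j%:R * eps.
  elim: j => [|j IHj] jB; first by exists x0; rewrite ?mul0r ?subr0.
  have [x Kx theta_x] := IHj (ltnW jB).
  apply: contrapT => no_y; apply: no_min; exists (B - j.+1)%N, x; split.
  - by rewrite ltn_subrL (leq_ltn_trans _ jB).
  - by rewrite -subSn // subSS.
  - move=> y Ky; rewrite leNgt; apply/negP => lt_y; apply: no_y; exists y => //.
    by rewrite -natr1 mulrDl mul1r; lra.
have [y _] := descent B (leqnn B).
by have := theta_ge0 y; lra.
Qed.

(** The arithmetic behind the factor 24 in [w] and [beta]: precision
    1/(24 D m^2 + 1) at both ends of a segment of length 2D gives precision 1/m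
    at its points, in the bound of [convex_almost_fixed]. *)
Lemma small_of_sqr_small {R : realType} (D m M a : R) :
  1 <= D -> 1 <= m -> M = 24 * D * m ^+ 2 + 1 -> 0 <= a ->
  a ^+ 2 <= 2 * D * M^-1 + M^-1 ^+ 2 -> a <= m^-1.
Proof.
move=> D1 m1 ME a0 a_le.
have mm : 1 <= m ^+ 2 by rewrite exprn_ege1.
have DM0 : m ^+ 2 <= D * m ^+ 2 by rewrite ler_peMl // (le_trans _ mm).
have M_gt0 : 0 < M by lra.
have m_gt0 : 0 < m by lra.
rewrite -[leRHS]mul1r ler_pdivlMr // -(@ler_pXn2r _ 2) ?nnegrE ?mulr_ge0 ?(ltW m_gt0) //.
have {}a_le : a ^+ 2 * M ^+ 2 <= 2 * D * M + 1.
  rewrite -ler_pdivlMr ?exprn_gt0 //; apply: le_trans a_le _.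
  by rewrite le_eqVlt; apply/orP; left; apply/eqP; field; lra.
rewrite exprMn expr1n -(@ler_pM2r _ (M ^+ 2)) ?exprn_gt0 // mul1r.
have := ler_wpM2l (_ : 0 <= m ^+ 2) a_le; rewrite sqr_ge0 => /(_ isT).
rewrite ME; set q := m ^+ 2 in mm DM0 *; nra.
Qed.

Section Projection.
Context {R : realType} {H : completeNormedModType R}.
Context {ip : {dot H for @idfun R}} (ip_norm : induces_norm ip).

(** An approximate minimizer x of |u - .| over the almost fixed points of T is
    compared with the points x + t(y - x) of the segment towards y; these are
    almost fixed by [convex_almost_fixed]. This yields
    2 t <u - x, y - x> <= t^2 |y - x|^2 + eps, and the choices
    t = 1/(4D^2(j+1)) and eps = t/(j+1) bound both terms on the right by
    t/(j+1). The number of decrements is D^2/eps = 4D^4(j+1)^2. *)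
Lemma approximate_projection (T : H -> H) (u p : H) (D j : nat) (g : nat -> nat) :
  (forall x y, `|T x - T y| <= `|x - y|) -> T p = p ->
  (0 < D)%N -> 2 * `|u - p| <= D%:R ->
  exists N x, [/\ (N <= beta D j g)%N, `|x - p| <= D%:R,
    `|x - T x| <= (g N).+1%:R^-1 &
    forall y, `|y - p| <= D%:R -> `|y - T y| <= N.+1%:R^-1 ->
      ip (u - x) (y - x) <= j.+1%:R^-1].
Proof.
move=> T_ne Tp D_gt0 up.
pose K n x := `|x - p| <= D%:R /\ `|x - T x| <= n.+1%:R^-1.
pose t : R := (4 * D%:R ^+ 2 * j.+1%:R)^-1.
have D1 : 1 <= D%:R :> R by rewrite ler1n.
have j1 : 1 <= j.+1%:R :> R by rewrite ler1n.
have den1 : 1 <= 4 * D%:R ^+ 2 * j.+1%:R :> R.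
  have : 1 <= D%:R ^+ 2 :> R by rewrite exprn_ege1.
  nra.
have t_gt0 : 0 < t by rewrite invr_gt0; lra.
have t_le1 : t <= 1 by rewrite invf_le1; lra.
have tE : 4 * D%:R ^+ 2 * t = j.+1%:R^-1.
  by rewrite /t; field; rewrite nat1r !pnatr_eq0 -!lt0n D_gt0.
pose eps := t * j.+1%:R^-1.
have [i [x [iB [xp Tx] x_min]]] : exists i x,
    [/\ (i < 4 * D ^ 4 * (j + 1) ^ 2)%N, K (iter i.+1 (w D g) 0%N) x &
      forall y, K (iter i (w D g) 0%N) y -> `|u - x| ^+ 2 <= `|u - y| ^+ 2 + eps].
  apply: (@approximate_minimum _ _ K (fun x => `|u - x| ^+ 2) _ _ _ p).
  - by move=> n; rewrite /K Tp !subrr normr0.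
  - by move=> x; rewrite sqr_ge0.
  - have -> : (4 * D ^ 4 * (j + 1) ^ 2)%:R * eps = D%:R ^+ 2.
      rewrite 2!natrM !natrX addn1 /eps /t; field.
      by rewrite nat1r !pnatr_eq0 -!lt0n D_gt0.
    have := normr_ge0 (u - p); nra.
set n := iter i (w D g) 0%N in x_min *.
pose N := (24 * D * (n + 1) ^ 2)%N.
have wn_ge : (N <= iter i.+1 (w D g) 0)%N by rewrite iterS /w leq_maxr.
have gN_le : (g N <= iter i.+1 (w D g) 0)%N by rewrite iterS /w leq_maxl.
exists N, x; split => //.
- have w_ge m : (m <= w D g m)%N.
    rewrite /w leq_max; apply/orP; right.
    by apply: (@leq_trans ((m + 1) ^ 2)); [nia|rewrite leq_pmull ?muln_gt0].
  have w_iter m : (n <= iter (m + i) (w D g) 0)%N.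
    by elim: m => [|m IHm] //; rewrite addSn iterS (leq_trans IHm).
  rewrite /beta /N leq_mul2l leq_exp2r // leq_add2r.
  by rewrite -(subnK (ltnW iB)) w_iter orbT.
- by apply: le_trans Tx _; rewrite lef_pV2 ?posrE ?ltr0n // ler_nat ltnS.
move=> y yp Ty; set v := (1 - t) *: x + t *: y.
have xy : `|x - y| <= 2 * D%:R.
  have -> : x - y = (x - p) - (y - p) by rewrite opprB addrA subrK.
  by apply: le_trans (ler_normB _ _) _; lra.
have Kv : K n v.
  split.
    have -> : v - p = (1 - t) *: (x - p) + t *: (y - p).
      by rewrite /v; vector_ring.
    apply: le_trans (ler_normD _ _) _; rewrite !normrZ !ger0_norm ?subr_ge0 //; last lra.
    by nra.
  have Tx' : `|x - T x| <= N.+1%:R^-1.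
    by apply: le_trans Tx _; rewrite lef_pV2 ?posrE ?ltr0n // ler_nat ltnS.
  have t01 : 0 <= t <= 1 by rewrite t_le1 ltW.
  have := convex_almost_fixed ip_norm T x y v _ _ t T_ne Tx' Ty xy t01 erefl.
  have : (N.+1%:R : R) = 24 * D%:R * n.+1%:R ^+ 2 + 1.
    by rewrite -natr1 /N 2!natrM natrX addn1.
  have := normr_ge0 (v - T v); set a := `|v - T v|.
  have : 1 <= n.+1%:R :> R by rewrite ler1n.
  set m := n.+1%:R; set M := N.+1%:R => m1 a0 ME a_le.
  exact: small_of_sqr_small D1 m1 ME a0 a_le.
have := x_min v Kv.
have -> : `|u - v| = `|(u - x) - t *: (y - x)| by congr `|_|; rewrite /v; vector_ring.
rewrite [X in _ <= X + _](sqr_normB ip_norm) !ipZr normrZ exprMn (ger0_norm (ltW t_gt0)).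
set I := ip (u - x) (y - x) => key.
have yx2 : `|y - x| ^+ 2 <= (2 * D%:R) ^+ 2.
  by rewrite lerXn2r ?nnegrE ?mulr_ge0 // distrC.
have k2 : t * (2 * I) <= t * (t * (2 * D%:R) ^+ 2 + j.+1%:R^-1).
  have := ler_wpM2l (sqr_ge0 t) yx2; rewrite /eps in key.
  by move: key tE; set iv := j.+1%:R^-1; rewrite !expr2 => key tE; nra.
rewrite ler_pM2l // in k2.
have e4 : t * (2 * D%:R) ^+ 2 = j.+1%:R^-1 by rewrite -tE; ring.
by rewrite e4 in k2; move: k2; set iv := j.+1%:R^-1 => k2; lra.
Qed.

End Projection.

(** * Recursive inequalities with divergent step sizes *)

Section TikhonovRecursion.
Context {R : realType}.
Implicit Types (s lam v : nat -> R) (a B : R).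

Lemma sum_natr_le s m n : (forall i, s i <= 1) ->
  \sum_(m <= i < n) s i <= (n - m)%:R.
Proof.
move=> s1; have -> : (n - m)%:R = \sum_(m <= i < n) (1 : R).
  by rewrite big_const_nat iter_addr addr0.
by apply: ler_sum.
Qed.

(** Unfolding the recursion contracts the initial bound B by the product of the
    1 - lam_i <= exp(-lam_i). The terms lam_i a average with weights of total at
    most 1, so they contribute a only once, whereas the v_i add up. *)
Lemma tikhonov_recursion s lam v a B m n : (m <= n)%N ->
  (forall i, (m <= i < n)%N -> 0 <= lam i <= 1) ->
  (forall i, (m <= i < n)%N -> 0 <= v i) ->
  0 <= B -> s m <= B -> 0 <= a ->
  (forall i, (m <= i < n)%N -> s i.+1 <= (1 - lam i) * s i + lam i * a + v i) ->
  s n <= B * expR (- \sum_(m <= i < n) lam i) + a + \sum_(m <= i < n) v i.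
Proof.
move=> + + + B0 smB a0; elim: n => [|n IHn] mn lam01 v0 rec.
  by move: mn; rewrite leqn0 => /eqP <-; rewrite !big_geq // oppr0 expR0; lra.
case: (ltngtP m n.+1) mn => // [mn|mE] _; last first.
  by rewrite -mE !big_geq // oppr0 expR0; lra.
have in_n i : (m <= i < n)%N -> (m <= i < n.+1)%N.
  by case/andP=> -> /ltnW.
have /IHn {}IHn : (m <= n)%N by [].
have {}IHn := IHn (fun i h => lam01 i (in_n i h)) (fun i h => v0 i (in_n i h))
  (fun i h => rec i (in_n i h)).
have nn : (m <= n < n.+1)%N by rewrite leqnn andbT.
have /andP[l0 l1] := lam01 n nn; have vn0 := v0 n nn.
have V0 : 0 <= \sum_(m <= i < n) v i.
  rewrite big_nat_cond sumr_ge0 // => i; rewrite andbT => /in_n; exact: v0.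
rewrite !big_nat_recr //= opprD expRD.
have e_ge := expR_ge1Dx (- lam n).
have := rec n nn; set S := \sum_(m <= i < n) lam i in IHn *.
move: V0 IHn; set V := \sum_(m <= i < n) v i => V0 IHn.
have P0 : 0 <= B * expR (- S) by rewrite mulr_ge0 ?expR_ge0.
have := ler_wpM2l P0 e_ge.
have := ler_wpM2l (_ : 0 <= 1 - lam n) IHn; rewrite subr_ge0 => /(_ l1).
have : 0 <= lam n * V by rewrite mulr_ge0.
move: P0; rewrite !mulrA; set P := B * expR (- S); lra.
Qed.

Lemma expR_ceil_ln (q : nat) : (0 < q)%N -> expR (- (ceil_ln R q)%:R) <= q%:R^-1 :> R.
Proof.
move=> q0; have q0' : 0 < q%:R :> R by rewrite ltr0n.
rewrite expRN lef_pV2 ?posrE ?expR_gt0 // -{1}(lnK q0') ler_expR.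
apply: le_trans (ceil_ge _) _.
by rewrite /ceil_ln natr_absz ler_int ler_norm.
Qed.

Section Divergence.
Context {lam : nat -> R} {L : nat -> nat}.
Hypothesis lam_itv : forall n, 0 < lam n < 1.
Hypothesis lam_div : forall k, k%:R <= \sum_(1 <= i < (L k).+1) lam i.

(** Each lam_i is less than 1, so at least k of them are required to reach k. *)
Lemma divergence_rate_ge k : (k <= L k)%N.
Proof.
rewrite -(ler_nat R); apply: le_trans (lam_div k) _.
rewrite -[X in _ <= X%:R](subn1 (L k).+1).
by apply: sum_natr_le => i; case/andP: (lam_itv i) => _ /ltW.
Qed.

(** The indices below m.+1 contribute at most m to the sum bounded in [lam_div],
    which is why the rate L is evaluated at m + k. *)
Lemma sum_divergence m k st n : (st <= m.+1)%N -> (L (m + k) < n)%N ->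
  k%:R <= \sum_(st <= i < n) lam i.
Proof.
move=> am Ln; have Lm := divergence_rate_ge (m + k).
have lam0 i : 0 <= lam i by case/andP: (lam_itv i) => /ltW.
have lam1 i : lam i <= 1 by case/andP: (lam_itv i) => _ /ltW.
have an : (m.+1 <= n)%N by apply: leq_ltn_trans Ln; apply: leq_trans Lm; rewrite leq_addr.
apply: (@le_trans _ _ (\sum_(m.+1 <= i < n) lam i)); last first.
  by rewrite [leRHS](big_cat_nat am an) /= lerDr sumr_ge0.
have := lam_div (m + k); rewrite natrD => h1.
have h2 : \sum_(1 <= i < (L (m + k)).+1) lam i <= \sum_(1 <= i < n) lam i.
  by rewrite [leRHS](@big_cat_nat _ _ _ (L (m + k)).+1) //= lerDl sumr_ge0.
have h3 : \sum_(1 <= i < n) lam i = \sum_(1 <= i < m.+1) lam i + \sum_(m.+1 <= i < n) lam i.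
  by rewrite -big_cat_nat.
have h4 := sum_natr_le lam 1 m.+1 lam1; rewrite subn1 /= in h4.
by rewrite h3 in h2; lra.
Qed.

(** [tikhonov_recursion] run for long enough that the product of the 1 - lam_i
    falls below 1/q, which happens when the sum of the lam_i exceeds ln q. *)
Lemma tikhonov_rate s v a B m q st n : (st <= m.+1)%N -> (0 < q)%N ->
  (L (m + ceil_ln R q) < n)%N ->
  (forall i, (st <= i < n)%N -> 0 <= v i) ->
  0 <= B -> s st <= B -> 0 <= a ->
  (forall i, (st <= i < n)%N -> s i.+1 <= (1 - lam i) * s i + lam i * a + v i) ->
  s n <= B / q%:R + a + \sum_(st <= i < n) v i.
Proof.
move=> am q0 Ln v0 B0 sB a0 rec.
have stn : (st <= n)%N.
  apply: leq_trans am (leq_ltn_trans _ Ln).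
  by apply: leq_trans (divergence_rate_ge _); rewrite leq_addr.
have := tikhonov_recursion s lam v a B st n stn _ v0 B0 sB a0 rec.
have lam01 i : (st <= i < n)%N -> 0 <= lam i <= 1.
  by move=> _; case/andP: (lam_itv i) => /ltW -> /ltW ->.
move=> /(_ lam01) /le_trans; apply; rewrite !lerD2r ler_wpM2l //.
apply: le_trans (expR_ceil_ln q q0); rewrite ler_expR lerN2.
exact: sum_divergence am Ln.
Qed.

End Divergence.
End TikhonovRecursion.

(** * One step of the exact iteration *)

Section TikhonovStep.
Context {R : realType} {H : completeNormedModType R}.
Context {ip : {dot H for @idfun R}} (ip_norm : induces_norm ip).
Context {A : H -> set H} (A_mono : monotone_op ip A).
Context {J : R -> H -> H} (J_res : is_resolvent A J).
Context {u p : H} {D : R} (Ap : zeros A p) (up : 2 * `|u - p| <= D).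
Implicit Types (x y : H) (s eps : R).

(** The three-point inequality of firm nonexpansivity around x, which would hold
    with eps = 0 for a zero x. With q = x - J x and t = y - J y, firmness bounds
    <J y - x, t> from below by <q, J y - J x - t>, and the second factor has norm
    at most 3D. *)
Lemma resolvent_almost_fixed_sqr s x y eps : 0 < s ->
  `|x - p| <= D -> `|y - p| <= D -> `|x - J s x| <= eps ->
  `|J s y - x| ^+ 2 <= `|y - x| ^+ 2 - `|y - J s y| ^+ 2 + 6 * D * eps.
Proof.
move=> s0 xp yp xJ.
have firm := resolvent_firm A_mono J_res s y x s0.
have yJ := le_trans (resolvent_displacement_le ip_norm A_mono J_res s y p s0 Ap) yp.
have yx : `|y - x| <= 2 * D.
  have -> : y - x = (y - p) - (x - p) by rewrite opprB addrA subrK.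
  by apply: le_trans (ler_normB _ _) _; lra.
have JJ := le_trans (resolvent_nonexpansive ip_norm A_mono J_res s y x s0) yx.
have -> : `|y - x| ^+ 2 = `|(J s y - x) + (y - J s y)| ^+ 2.
  by congr (`|_| ^+ 2); vector_ring.
rewrite [X in _ <= X - _ + _](sqr_normD ip_norm).
set q := x - J s x in firm xJ *; set t := y - J s y in firm yJ *.
have -> : ip (J s y - x) t = ip (J s y - J s x) (t - q) + ip q (J s y - J s x - t).
  by rewrite /q /t !ipE !(ipC x) !(ipC (J s x)); ring.
have h1 := ip_le_norm ip_norm (- q) (J s y - J s x - t).
rewrite ipNl normrN in h1.
have h2 : `|J s y - J s x - t| <= 3 * D.
  by apply: le_trans (ler_normB _ _) _; lra.
have h3 := ler_pM (normr_ge0 q) (normr_ge0 _) xJ h2.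
lra.
Qed.

(** With a = y - x and b = J y - x, expanding |gam a + del b|^2 produces - gam del |a - b|^2, and
    [resolvent_almost_fixed_sqr] contributes - del (1 - lam) |a - b|^2. Together
    the coefficient is del (del + 2 gam) >= del^2, hence the term in [kappa]. *)
Lemma tikhonov_step s lam gam del kappa eps x y y' : 0 < s ->
  0 <= lam -> 0 <= gam -> 0 <= del -> lam + gam + del = 1 ->
  kappa <= del ^+ 2 ->
  `|x - p| <= D -> `|y - p| <= D -> `|x - J s x| <= eps ->
  y' = lam *: u + gam *: y + del *: J s y ->
  `|y' - x| ^+ 2 <= (1 - lam) * `|y - x| ^+ 2
     + 2 * lam * ip (u - x) (y' - x) - kappa * `|y - J s y| ^+ 2 + 6 * D * eps.
Proof.
move=> s0 l0 g0 d0 sum1 kd xp yp xJ yE.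
have key := resolvent_almost_fixed_sqr s x y eps s0 xp yp xJ.
set a := y - x in key *; set b := J s y - x in key *.
have De : 0 <= D * eps.
  rewrite mulr_ge0 ?(le_trans _ xJ) //; apply: le_trans xp; exact: normr_ge0.
have abE : y - J s y = a - b by rewrite /a /b opprB addrA subrK.
have y'E : gam *: a + del *: b = (y' - x) - lam *: (u - x).
  have lamE : lam = 1 - gam - del by lra.
  by rewrite yE lamE /a /b; vector_ring.
have h1 : `|y' - x| ^+ 2 <= `|gam *: a + del *: b| ^+ 2 + 2 * lam * ip (u - x) (y' - x).
  rewrite y'E [in X in _ <= X](sqr_normB ip_norm) ipZr (ipC (u - x)).
  by have := sqr_ge0 `|lam *: (u - x)|; lra.
apply: le_trans h1 _.
have -> : `|gam *: a + del *: b| ^+ 2 = (gam + del) * (gam * `|a| ^+ 2 + del * `|b| ^+ 2)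
    - gam * del * `|y - J s y| ^+ 2.
  by rewrite abE (sqr_norm_comb ip_norm).
set t := `|y - J s y| ^+ 2 in key *.
have t0 : 0 <= t by rewrite sqr_ge0.
have a0 := sqr_ge0 `|a|; set P := `|a| ^+ 2 in key a0 *.
set Q := `|b| ^+ 2 in key *.
have sdE : gam + del = 1 - lam by lra.
have s01 : 0 <= gam + del <= 1 by apply/andP; split; lra.
case/andP: s01 => s_ge s_le.
have h2 : (gam + del) * del * Q <= (gam + del) * del * (P - t + 6 * D * eps).
  by rewrite ler_wpM2l // mulr_ge0.
have h3 : (gam + del) * del * (D * eps) <= D * eps.
  rewrite ler_piMl // mulr_ile1 //; lra.
have h4 : kappa * t <= del ^+ 2 * t by rewrite ler_wpM2r.
have h5 : (gam + del) * (gam + del) * P <= (1 - lam) * P.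
  by rewrite ler_wpM2r // -sdE ler_piMl.
have h6 : 0 <= gam * del * t by rewrite !mulr_ge0.
lra.
Qed.

Lemma tikhonov_bounded s lam gam del y : 0 < s ->
  0 <= lam -> 0 <= gam -> 0 <= del -> lam + gam + del = 1 ->
  `|y - p| <= D -> `|lam *: u + gam *: y + del *: J s y - p| <= D.
Proof.
move=> s0 l0 g0 d0 sum1 yp.
have -> : lam *: u + gam *: y + del *: J s y - p =
    lam *: (u - p) + gam *: (y - p) + del *: (J s y - p).
  have -> : lam = 1 - gam - del by lra.
  by vector_ring.
have Jp := le_trans (resolvent_dist_zero ip_norm A_mono J_res s y p s0 Ap) yp.
have un := normr_ge0 (u - p).
apply: le_trans (ler_normD _ _) _; rewrite normrZ (ger0_norm d0).
apply: (@le_trans _ _ (lam * D + gam * D + del * D)); last first.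
  by rewrite -!mulrDl sum1 mul1r.
rewrite lerD ?ler_wpM2l //; apply: le_trans (ler_normD _ _) _.
rewrite !normrZ !ger0_norm // lerD ?ler_wpM2l //; move: up; lra.
Qed.

(** In the increasing case y_m is shown to be almost fixed while the recursive
    inequality involves y_(m+1); this lemma passes from one to the other. *)
Lemma tikhonov_move s lam gam del y : 0 <= lam -> 0 <= del -> del <= 1 ->
  lam + gam + del = 1 -> `|y - p| <= D ->
  `|lam *: u + gam *: y + del *: J s y - y| <= lam * (3 / 2 * D) + `|y - J s y|.
Proof.
move=> l0 d0 d1 sum1 yp.
have -> : lam *: u + gam *: y + del *: J s y - y =
    lam *: ((u - p) - (y - p)) + (- del) *: (y - J s y).
  have -> : lam = 1 - gam - del by lra.
  by vector_ring.
apply: le_trans (ler_normD _ _) _; rewrite !normrZ normrN !ger0_norm // lerD //.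
  rewrite ler_wpM2l //; apply: le_trans (ler_normB _ _) _.
  by have := normr_ge0 (u - p); move: up; lra.
by rewrite ler_piMl.
Qed.

End TikhonovStep.

(** * Monotone iterates and nonincreasing sequences *)

Section Monotonicity.
Implicit Types g : nat -> nat.

Lemma nat_monotone_leq g m n : nat_monotone g -> (m <= n)%N -> (g m <= g n)%N.
Proof.
by move=> g_mono; exact: (homo_leq leqnn leq_trans g_mono).
Qed.

Lemma iter_nondecreasing g n : nat_monotone g -> (n <= g n)%N ->
  forall a b, (a <= b)%N -> (iter a g n <= iter b g n)%N.
Proof.
move=> g_mono ng a b; apply: (homo_leq leqnn leq_trans) => i.
by elim: i => [|i IHi] //=; apply: nat_monotone_leq.
Qed.

(** A monotone g is iterated from n either upwards, when n <= g n, or downwards;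
    this is what the maximum in [phi2] accounts for. *)
Lemma iter_leq_max g a b m n : nat_monotone g -> (a <= b)%N -> (m <= n)%N ->
  (iter a g m <= maxn n (iter b g n))%N.
Proof.
move=> g_mono ab mn; have iter_mn : (iter a g m <= iter a g n)%N.
  by elim: (a) => [|i IHi] //; rewrite !iterS nat_monotone_leq.
apply: leq_trans iter_mn _; rewrite leq_max; case: (leqP n (g n)) => [ng|/ltnW gn].
  by rewrite iter_nondecreasing ?orbT.
suff -> : (iter a g n <= n)%N by [].
by elim: (a) => [|i IHi] //; rewrite iterS (leq_trans _ gn) ?nat_monotone_leq.
Qed.

End Monotonicity.

Section RealSequences.
Context {R : realType}.
Implicit Types (s : nat -> R) (g : nat -> nat).

Lemma nonincreasing_drop s m n : (m <= n)%N ->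
  (forall i, (m <= i < n)%N -> s i.+1 <= s i) -> s n <= s m.
Proof.
elim: n => [|n IHn]; first by rewrite leqn0 => /eqP ->.
rewrite leq_eqVlt => /predU1P[-> //|mn] s_dec.
apply: (@le_trans _ _ (s n)); first by apply: s_dec; rewrite leqnn andbT.
by apply: IHn => // i /andP[mi im]; apply: s_dec; rewrite mi ltnW.
Qed.

(** When n <= g n the iterates of g cut out B = 4D^2(j+1) consecutive windows.
    The total decrease over them is at most 4D^2 = B/(j+1), so one window has a
    decrease of at most 1/(j+1). When g n < n the window at n is empty. *)
Lemma nonincreasing_metastable s g (D j n : nat) : nat_monotone g -> (0 < D)%N ->
  (forall i, 0 <= s i) -> s n <= 4 * D%:R ^+ 2 ->
  (forall i, (n <= i < phi1 D j n g)%N -> s i.+1 <= s i) ->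
  exists m, [/\ (n <= m <= phi2 D j n g)%N &
    forall i, (m <= i < g m)%N -> s i - s i.+1 <= j.+1%:R^-1].
Proof.
move=> g_mono D_gt0 s_ge0 s_le s_dec.
case: (leqP (g n) n) => [gn|/ltnW ng].
  exists n; split; first by rewrite leqnn /phi2 leq_maxl.
  by move=> i /andP[ni /leq_trans/(_ gn)]; rewrite ltnNge ni.
set B := (4 * D ^ 2 * (j + 1))%N.
have iter_mono := iter_nondecreasing g n g_mono ng.
have B_phi1 : (iter B g n <= phi1 D j n g)%N.
  rewrite /phi1; apply: leq_trans (nat_monotone_leq g _ _ g_mono (leq_maxr _ _)).
  by rewrite -iterS iter_mono.
have [i iB drop] : exists2 i, (i < B)%N &
    s (iter i g n) - s (iter i.+1 g n) <= j.+1%:R^-1.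
  apply: contrapT => no_i.
  have descent i : (i <= B)%N -> s (iter i g n) <= 4 * D%:R ^+ 2 - i%:R * j.+1%:R^-1.
    elim: i => [|i IHi] iB; first by rewrite mul0r subr0.
    have := IHi (ltnW iB); suff : j.+1%:R^-1 < s (iter i g n) - s (iter i.+1 g n).
      by rewrite -[in X in _ -> _ -> X]natr1; set q := j.+1%:R^-1; lra.
    by rewrite ltNge; apply/negP => drop; apply: no_i; exists i.
  have B_gt0 : (0 < B)%N by rewrite /B !muln_gt0 !D_gt0 addn1.
  apply: no_i; exists B.-1; first by rewrite prednK.
  have := descent B.-1; rewrite prednK // leq_pred => /(_ isT).
  have BE : B%:R * j.+1%:R^-1 = 4 * D%:R ^+ 2 :> R.
    by rewrite /B addn1 2!natrM natrX mulfK // pnatr_eq0.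
  have : B%:R = B.-1%:R + 1 :> R by rewrite natr1 prednK.
  move=> BS; rewrite BS in BE; move: BE (s_ge0 (iter B g n)).
  by set q := j.+1%:R^-1; lra.
exists (iter i g n); split.
  by rewrite {1}(iter_mono 0%N i isT) /phi2 leq_max (iter_mono i B (ltnW iB)) orbT.
move=> a /andP[ia ai]; apply: le_trans drop; rewrite -iterS in ai.
have dec b : (iter i g n <= b < iter i.+1 g n)%N -> s b.+1 <= s b.
  move=> /andP[ib bi]; apply: s_dec; rewrite (leq_trans (iter_mono 0%N i isT) ib).
  by rewrite (leq_trans bi) // (leq_trans _ B_phi1) // iter_mono.
have h1 : s a <= s (iter i g n).
  apply: nonincreasing_drop => // b /andP[ib ba]; apply: dec.
  by rewrite ib (ltn_trans ba).
have h2 : s (iter i.+1 g n) <= s a.+1.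
  apply: nonincreasing_drop => // b /andP[ab bi]; apply: dec.
  by rewrite bi andbT (leq_trans ia) // ltnW.
lra.
Qed.

Lemma last_increase s i n : (i < n)%N -> s i < s i.+1 ->
  exists m, [/\ (i <= m < n)%N, s m < s m.+1 & s n <= s m.+1].
Proof.
move=> + si; elim: n => [//|n IHn]; rewrite ltnS leq_eqVlt => /predU1P[<-|i_n].
  by exists i; rewrite leqnn ltnSn.
case: (ltP (s n) (s n.+1)) => [sn|sn].
  by exists n; rewrite (ltnW i_n) ltnSn.
have [m [/andP[im mn] sm nm]] := IHn i_n.
by exists m; split=> //; [rewrite im ltnW|exact: le_trans nm].
Qed.

End RealSequences.

(** * Numerical estimates *)

Section Estimates.
Context {R : realType}.
Implicit Types (c D n r t lam err eps K hm : R).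

(** The weights 12, 96 and 2(12cn^2 - 1) come from [r1], [r3] and [Xi1]; the
    three contributions to (n t)^2 are at most 1/12 + 6/96 + 1/22. *)
Lemma slow_decrease_displacement c D n t lam drop I err : 1 <= c -> 1 <= n ->
  0 <= t -> 0 <= lam -> 0 <= err -> I <= 6 * D ^+ 2 ->
  c^-1 * t ^+ 2 <= drop + lam * I + err ->
  drop * (12 * c * n ^+ 2) <= 1 -> lam * (96 * c * D ^+ 2 * n ^+ 2) <= 1 ->
  err * (2 * (12 * c * n ^+ 2 - 1)) <= 1 -> t <= n^-1.
Proof.
move=> c1 n1 t0 l0 e0 ID key drop_le lam_le err_le.
have n0 : 0 < n by lra.
have nn : 1 <= n ^+ 2 by rewrite exprn_ege1.
have cn : 1 <= c * n ^+ 2 by rewrite -[leLHS]mulr1 ler_pM.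
have lI : lam * I <= lam * (6 * D ^+ 2) by rewrite ler_wpM2l.
have {}key : t ^+ 2 <= c * (drop + lam * (6 * D ^+ 2) + err).
  by rewrite -ler_pdivrMl; [lra|lra].
rewrite -[leRHS]mul1r ler_pdivlMr // -(@ler_pXn2r _ 2) ?nnegrE ?mulr_ge0 ?(ltW n0) //.
rewrite exprMn expr1n.
have := ler_wpM2r (_ : 0 <= n ^+ 2) key; rewrite sqr_ge0 => /(_ isT).
have : err * (2 * (11 * (c * n ^+ 2))) <= 1.
  by apply: le_trans err_le; rewrite ler_wpM2l //; lra.
lra.
Qed.

(** Same estimate when the squared distance increases, with r = r2(N): the
    contributions to (r t)^2 are at most 6/16 + 1/4. *)
Lemma increase_displacement c D r t lam I err : 1 <= c -> 1 <= r ->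
  0 <= t -> 0 <= lam -> I <= 6 * D ^+ 2 ->
  c^-1 * t ^+ 2 <= lam * I + err ->
  lam * (16 * c * r ^+ 2 * D ^+ 2) <= 1 -> err * (4 * c * r ^+ 2) <= 1 ->
  t <= r^-1.
Proof.
move=> c1 r1 t0 l0 ID key lam_le err_le.
have r0 : 0 < r by lra.
have lI : lam * I <= lam * (6 * D ^+ 2) by rewrite ler_wpM2l.
have {}key : t ^+ 2 <= c * (lam * (6 * D ^+ 2) + err).
  by rewrite -ler_pdivrMl; [lra|lra].
rewrite -[leRHS]mul1r ler_pdivlMr // -(@ler_pXn2r _ 2) ?nnegrE ?mulr_ge0 ?(ltW r0) //.
rewrite exprMn expr1n.
have := ler_wpM2r (_ : 0 <= r ^+ 2) key; rewrite sqr_ge0 => /(_ isT).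
lra.
Qed.

(** Here s is the squared distance after the last increase. The recursive
    inequality gives lam s <= 2 lam I' + err; since err <= lam/(16K^2) by the lower
    bound 1/hm on lam, dividing by lam is harmless. I' differs from I by the
    displacement bounded in [tikhonov_move]. *)
Lemma increase_small D K t lam hm s I I' err : 1 <= D -> 1 <= K -> 0 <= t ->
  0 < lam -> 0 <= err ->
  I * (32 * K ^+ 2) <= 1 -> I' <= I + 3 / 2 * D * (lam * (3 / 2 * D) + t) ->
  t * (128 * D * K ^+ 2) <= 1 -> lam * (256 * D ^+ 2 * K ^+ 2) <= 1 ->
  lam * s <= 2 * lam * I' + err -> 1 <= hm * lam ->
  err * (16 * hm * K ^+ 2) <= 1 -> s * K <= 1.
Proof.
move=> D1 K1 t0 l0 e0 I_le I'_le t_le lam_le s_le hlam err_le.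
have K0 : 0 <= K ^+ 2 by rewrite sqr_ge0.
have h1 : err * (16 * K ^+ 2) <= lam.
  apply: (@le_trans _ _ (err * (16 * hm * K ^+ 2) * lam)); last by rewrite ler_piMl // ltW.
  have -> : err * (16 * hm * K ^+ 2) * lam = err * (16 * K ^+ 2) * (hm * lam) by ring.
  by rewrite ler_peMr // mulr_ge0 // mulr_ge0.
have h2 : I' * K ^+ 2 <= (I + 3 / 2 * D * (lam * (3 / 2 * D) + t)) * K ^+ 2.
  by rewrite ler_wpM2r.
have h3 : lam * (s * K ^+ 2) <= lam * (2 * (I' * K ^+ 2) + 16^-1).
  by have := ler_wpM2r K0 s_le; lra.
rewrite ler_pM2l // in h3.
have h4 : s * K ^+ 2 <= 1 by lra.
case: (leP s 0) => s0; first by nra.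
by apply: le_trans h4; rewrite ler_pM2l // ler_peMr //; lra.
Qed.

Lemma error_le (j : nat) D eps (y : R) : 0 <= D -> 0 <= y -> eps = j.+1%:R^-1 ->
  (6 * D + 1) * y <= j.+1%:R -> 6 * D * eps * y <= 1.
Proof.
move=> D0 y0 ->; have : 0 < j.+1%:R :> R by rewrite ltr0n.
set J := j.+1%:R => J0 h.
have -> : 6 * D * J^-1 * y = (6 * D * y) / J by ring.
by rewrite ler_pdivrMr //; nra.
Qed.

End Estimates.

(** * Metastability of the exact iteration *)

Definition sqr_dist {R : realType} {H : completeNormedModType R} (y : nat -> H)
    (x : H) (i : nat) : R := `|y i - x| ^+ 2.

Section ExactIteration.
Context {R : realType} {H : completeNormedModType R}.
Context {ip : {dot H for @idfun R}} (ip_norm : induces_norm ip).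
Context {A : H -> set H} (A_mono : monotone_op ip A).
Context {J : R -> H -> H} (J_res : is_resolvent A J).
Context {u : H} {cs lam del gam : nat -> R} {y : nat -> H}.
Hypothesis lam_itv : forall n, 0 < lam n < 1.
Hypothesis del_itv : forall n, 0 < del n < 1.
Hypothesis gam_ge0 : forall n, 0 <= gam n.
Hypothesis sum_eq1 : forall n, lam n + gam n + del n = 1.
Hypothesis y_S : forall n, y n.+1 =
  lam n *: u + gam n *: y n + del n *: J (cs n) (y n).
Context {c : nat} (c_gt0 : (0 < c)%N) {h l L : nat -> nat}.
Hypothesis h_gt0 : forall n, (0 < h n)%N.
Hypotheses (h_mono : nat_monotone h) (l_mono : nat_monotone l).
Hypothesis L_mono : nat_monotone L.
Hypothesis lam_ge : forall n, (h n)%:R^-1 <= lam n.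
Hypothesis lam_le : forall k n, (l k <= n)%N -> lam n <= k.+1%:R^-1.
Hypothesis lam_div : forall k, k%:R <= \sum_(1 <= i < (L k).+1) lam i.
Hypothesis cs_del_ge : forall n, c%:R^-1 <= Num.min (cs n) (del n ^+ 2).
Context {D : nat} (D_gt0 : (0 < D)%N) {p : H} (Ap : zeros A p).
Hypothesis up : 2 * `|u - p| <= D%:R.
Hypothesis y0p : `|y 0%N - p| <= D%:R.
Context {C : nat -> nat} (C_mono : nat_monotone C).
Hypothesis cs_le : forall n, cs n <= (C n)%:R.

Local Notation s := (sqr_dist y).
Let c0 : 0 < c%:R^-1 :> R. Proof. by rewrite invr_gt0 ltr0n. Qed.
Let cs_ge i : c%:R^-1 <= cs i.
Proof. by have := cs_del_ge i; rewrite le_min => /andP[]. Qed.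
Let del_ge i : c%:R^-1 <= del i ^+ 2.
Proof. by have := cs_del_ge i; rewrite le_min => /andP[]. Qed.
Let cs_gt0 i : 0 < cs i. Proof. exact: lt_le_trans (cs_ge i). Qed.
Let lam_ge0 i : 0 <= lam i. Proof. by case/andP: (lam_itv i) => /ltW. Qed.
Let lam_le1 i : lam i <= 1. Proof. by case/andP: (lam_itv i) => _ /ltW. Qed.
Let del_ge0 i : 0 <= del i. Proof. by case/andP: (del_itv i) => /ltW. Qed.
Let del_le1 i : del i <= 1. Proof. by case/andP: (del_itv i) => _ /ltW. Qed.

Lemma C_gt0 n : (0 < C n)%N.
Proof. by rewrite -(ltr_nat R) (lt_le_trans (cs_gt0 n)). Qed.

Lemma exact_bounded n : `|y n - p| <= D%:R.
Proof.
elim: n => [//|n IHn]; rewrite y_S.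
exact: (tikhonov_bounded ip_norm A_mono J_res Ap up).
Qed.

Lemma ball_dist (x x' : H) : `|x - p| <= D%:R -> `|x' - p| <= D%:R ->
  `|x - x'| <= 2 * D%:R.
Proof.
move=> xp xp'; have -> : x - x' = (x - p) - (x' - p) by rewrite opprB addrA subrK.
by apply: le_trans (ler_normB _ _) _; lra.
Qed.

Lemma anchor_dist x : `|x - p| <= D%:R -> `|u - x| <= 3 / 2 * D%:R.
Proof.
move=> xp; have -> : u - x = (u - p) - (x - p) by rewrite opprB addrA subrK.
by apply: le_trans (ler_normB _ _) _; move: up xp; lra.
Qed.

Lemma anchor_ip_le x i : `|x - p| <= D%:R -> 2 * ip (u - x) (y i - x) <= 6 * D%:R ^+ 2.
Proof.
move=> xp; have h1 := ip_le_norm ip_norm (u - x) (y i - x).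
have := ler_pM (normr_ge0 _) (normr_ge0 _) (anchor_dist x xp)
  (ball_dist _ _ (exact_bounded i) xp).
lra.
Qed.

(** Displacements grow at most linearly in the resolvent parameter
    ([resolvent_monotone_param]): passing from 1/c to c_i costs a factor
    c c_i <= c C(n), which is the one built into [zeta]. *)
Lemma zeta_almost_fixed x Z j n i :
  `|x - J c%:R^-1 x| <= Z.+1%:R^-1 -> (zeta c C j n <= Z)%N -> (i <= n)%N ->
  `|x - J (cs i) x| <= j.+1%:R^-1.
Proof.
move=> xJ zZ ni.
have [_] := resolvent_monotone_param ip_norm A_mono J_res c%:R^-1 (cs i) x c0 (cs_ge i).
have c0' : 0 < c%:R :> R by rewrite ltr0n.
rewrite ler_pdivrMl // => /le_trans; apply.
have le1 : cs i * `|x - J c%:R^-1 x| <= (C n)%:R * (c * (j + 1) * C n)%:R^-1.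
  apply: ler_pM => //; first exact: ltW.
    by apply: le_trans (cs_le i) _; rewrite ler_nat nat_monotone_leq.
  apply: le_trans xJ _; rewrite lef_pV2 ?posrE ?ltr0n ?muln_gt0 ?c_gt0 ?C_gt0 ?addn1 //.
  by rewrite ler_nat; move: zZ; rewrite /zeta addn1; lia.
apply: le_trans (ler_wpM2l (ltW c0') le1) _.
rewrite le_eqVlt; apply/orP; left; apply/eqP; rewrite !natrM addn1.
have : j.+1%:R != 0 :> R by rewrite pnatr_eq0.
have : (C n)%:R != 0 :> R by rewrite pnatr_eq0 -lt0n C_gt0.
by move=> Cn q0; field; rewrite nat1r q0 Cn gt_eqF.
Qed.

Lemma exact_step x i eps : `|x - p| <= D%:R -> `|x - J (cs i) x| <= eps ->
  s x i.+1 <= (1 - lam i) * s x i + lam i * (2 * ip (u - x) (y i.+1 - x))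
    - c%:R^-1 * `|y i - J (cs i) (y i)| ^+ 2 + 6 * D%:R * eps.
Proof.
move=> xp xJ; have := (tikhonov_step ip_norm A_mono J_res Ap _ _ _ _ _ _ _ _ _
  (cs_gt0 i) (lam_ge0 i) (gam_ge0 i)
  (del_ge0 i) (sum_eq1 i) (del_ge i) xp (exact_bounded i) xJ (y_S i)).
by rewrite /sqr_dist; lra.
Qed.

Lemma sqr_dist_le x i : `|x - p| <= D%:R -> s x i <= 4 * D%:R ^+ 2.
Proof.
move=> xp; have -> : 4 * D%:R ^+ 2 = (2 * D%:R) ^+ 2 :> R by ring.
by rewrite /sqr_dist lerXn2r ?nnegrE ?mulr_ge0 // ball_dist // exact_bounded.
Qed.

Lemma lam_scale_le k i X : (l k <= i)%N -> (X <= k.+1)%N -> lam i * X%:R <= 1.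
Proof.
move=> ki Xk; apply: (@le_trans _ _ (k.+1%:R^-1 * k.+1%:R)); last first.
  by rewrite mulVf // pnatr_eq0.
by rewrite ler_pM ?ler_nat // lam_le.
Qed.

Lemma displacement_param_le i (w : R) :
  `|y i - J (cs i) (y i)| <= w -> `|y i - J c%:R^-1 (y i)| <= w.
Proof.
apply: le_trans.
by have [] := resolvent_monotone_param ip_norm A_mono J_res c%:R^-1 (cs i) (y i) c0 (cs_ge i).
Qed.

Lemma lam_scale_pred_le k i X : (l k <= i)%N -> (X - 1 <= k)%N -> lam i * X%:R <= 1.
Proof. by move=> ki Xk; apply: (lam_scale_le k) => //; lia. Qed.

Section Index.
Context {k : nat} {f : nat -> nat} (f_mono : nat_monotone f).

Lemma sigma_bar_mono m n : (m <= n)%N -> (sigma_bar R D L k m <= sigma_bar R D L k n)%N.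
Proof. by move=> mn; rewrite leq_add2r nat_monotone_leq ?leq_add2r. Qed.

Lemma f_tilde_leq m n : (m <= n)%N -> (f_tilde R D L k f m <= f_tilde R D L k f n)%N.
Proof. by move=> mn; exact: nat_monotone_leq f_mono (sigma_bar_mono _ _ mn). Qed.

Lemma f_tilde2_mono : nat_monotone (f_tilde2 R D L k f).
Proof. by move=> n; rewrite leq_add2r f_tilde_leq. Qed.

Lemma r1_succ n : (r1 c n).+1 = (12 * c * (n + 1) ^ 2)%N.
Proof. by rewrite /r1 subn1 prednK // !muln_gt0 c_gt0 addn1. Qed.

Lemma r1_leq m n : (m <= n)%N -> (r1 c m <= r1 c n)%N.
Proof. by move=> mn; rewrite leq_sub2r // leq_mul2l leq_exp2r // leq_add2r mn orbT. Qed.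

Lemma r2_leq m n : (m <= n)%N -> (r2 D k m <= r2 D k n)%N.
Proof. by move=> mn; rewrite /r2; lia. Qed.

Lemma r3_leq m n : (m <= n)%N -> (r3 c D l k m <= r3 c D l k n)%N.
Proof.
move=> mn; apply: (nat_monotone_leq l _ _ l_mono).
rewrite !geq_max -!andbA; apply/and3P; split.
- rewrite !leq_max leq_sub2r // leq_mul2l leq_exp2r // leq_add2r mn orbT //.
- by rewrite !leq_max leqnn orbT.
- by rewrite leq_max leq_mul2r leq_mul2l leq_exp2r // r2_leq // !orbT.
Qed.

(** Monotonicity in the index is what lets the unknown N <= beta be replaced by
    beta in the final bound; the same holds for [Phi_leq]. *)
Lemma phi2_leq m n :  (m <= n)%N ->
  (phi2 D (r1 c m) (r3 c D l k m) (f_tilde2 R D L k f) <=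
   phi2 D (r1 c n) (r3 c D l k n) (f_tilde2 R D L k f))%N.
Proof.
move=> mn; rewrite {1}/phi2 geq_max; apply/andP; split.
  by rewrite leq_max r3_leq.
apply: iter_leq_max; [exact: f_tilde2_mono|rewrite leq_mul2l|exact: r3_leq].
by rewrite leq_add2r r1_leq ?orbT.
Qed.

Lemma Phi_leq m n : (m <= n)%N -> (Phi R c D l L k f m <= Phi R c D l L k f n)%N.
Proof. by move=> mn; exact: nat_monotone_leq f_tilde2_mono (phi2_leq _ _ mn). Qed.

Context {x : H} {N : nat} (xp : `|x - p| <= D%:R).
Hypothesis xJ : `|x - J c%:R^-1 x| <= (Xi R c D C h l L k f N).+1%:R^-1.
Hypothesis x_proj : forall y', `|y' - p| <= D%:R ->
  `|y' - J c%:R^-1 y'| <= N.+1%:R^-1 -> ip (u - x) (y' - x) <= (k_bar k).+1%:R^-1.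

Let k_barE : (k_bar k).+1%:R = 32 * k.+1%:R ^+ 2 :> R.
Proof. by rewrite /k_bar subn1 prednK ?muln_gt0 ?addn1 // natrM natrX. Qed.

(** On the window selected by [nonincreasing_metastable] every y_i is almost
    fixed, so <u - x, y_(i+1) - x> <= 1/(32(k+1)^2) and [tikhonov_rate] applies. At
    [sigma_bar] the initial bound 4D^2 has shrunk to 1/(3(k+1)); the errors, at
    most f_tilde + 1 of them, add up to 1/(6(k+1)) thanks to [r4]. The summand 2 in
    [f_tilde2] keeps the decrease from y_(i+1) to y_(i+2), on which the bound for
    y_(i+1) rests, inside the window. *)
Lemma exact_metastable_decreasing :
  (forall i, (r3 c D l k N <= i < Phi R c D l L k f N)%N -> s x i.+1 <= s x i) ->
  exists2 m, (m <= phi2 D (r1 c N) (r3 c D l k N) (f_tilde2 R D L k f))%N &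
    forall i, (sigma_bar R D L k m <= i <= f (sigma_bar R D L k m))%N ->
      s x i <= k.+1%:R^-1.
Proof.
move=> s_dec.
have s_ge0 i : 0 <= s x i by rewrite sqr_ge0.
have [m [/andP[rm mphi] drop]] := nonincreasing_metastable (s x) _ _ _ _
  f_tilde2_mono D_gt0 s_ge0 (sqr_dist_le _ _ xp) s_dec.
exists m => // M /andP[sM Mf].
set F := f_tilde R D L k f (phi2 D (r1 c N) (r3 c D l k N) (f_tilde2 R D L k f)).
have gm : (f_tilde2 R D L k f m <= Phi R c D l L k f N)%N.
  exact: nat_monotone_leq f_tilde2_mono mphi.
set jj := (2 * (6 * D + 1) * maxn (r1 c N) (r4 R c D l L k f N) - 1)%N.
have jjS : jj.+1 = (2 * (6 * D + 1) * maxn (r1 c N) (r4 R c D l L k f N))%N.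
  rewrite /jj subn1 prednK // !muln_gt0 addn1 /= leq_max /r4; apply/orP; right.
  by rewrite !addn1.
pose eps : R := jj.+1%:R^-1.
have x_fixed i : (i <= Phi R c D l L k f N)%N -> `|x - J (cs i) x| <= eps.
  by move=> iPhi; apply: zeta_almost_fixed xJ _ iPhi; rewrite /Xi leq_maxl.
pose err := 6 * D%:R * eps.
have err0 : 0 <= err by apply: mulr_ge0; [apply: mulr_ge0|rewrite invr_ge0].
have err_le q : (q <= maxn (r1 c N) (r4 R c D l L k f N))%N -> err * (2 * q%:R) <= 1.
  move=> qm; apply: (@error_le _ jj) => //.
  have -> : (6 * D%:R + 1) * (2 * q%:R) = (2 * (6 * D + 1) * q)%:R :> R.
    by rewrite !natrM natrD natrM; ring.
  by rewrite ler_nat jjS leq_mul2l qm orbT.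
have err_r1 : err * (2 * (12 * c%:R * N.+1%:R ^+ 2 - 1)) <= 1.
  have -> : 12 * c%:R * N.+1%:R ^+ 2 - 1 = (r1 c N)%:R :> R.
    have : ((r1 c N).+1%:R : R) = 12 * c%:R * N.+1%:R ^+ 2.
      by rewrite r1_succ 2!natrM natrX addn1.
    by rewrite -natr1; lra.
  by rewrite err_le // leq_maxl.
have err_r4 : err * (6 * k.+1%:R * F.+1%:R) <= 1.
  have -> : 6 * k.+1%:R * F.+1%:R = 2 * (r4 R c D l L k f N)%:R :> R.
    by rewrite /r4 -/F !addn1 !natrM; ring.
  by rewrite err_le // leq_maxr.
have lam_small i : (m <= i)%N -> lam i * (96 * c%:R * D%:R ^+ 2 * N.+1%:R ^+ 2) <= 1.
  move=> mi.
  have -> : 96 * c%:R * D%:R ^+ 2 * N.+1%:R ^+ 2 =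
      (96 * c * D ^ 2 * (N + 1) ^ 2)%:R :> R.
    by rewrite 3!natrM 2!natrX addn1.
  by apply: (lam_scale_pred_le _ _ _ (leq_trans rm mi)); rewrite !leq_max leqnn.
have displacement i : (m <= i < f_tilde2 R D L k f m)%N ->
    `|y i - J (cs i) (y i)| <= N.+1%:R^-1.
  move=> /andP[mi ig].
  have step := exact_step x i eps xp (x_fixed i (leq_trans (ltnW ig) gm)).
  apply: (@slow_decrease_displacement _ c%:R D%:R _ _ (lam i) (s x i - s x i.+1)
    (2 * ip (u - x) (y i.+1 - x)) err) => //; rewrite ?ler1n //.
  - exact: anchor_ip_le.
  - have : 0 <= lam i * s x i by rewrite mulr_ge0.
    by move: step; rewrite -/err; set q := c%:R^-1; lra.
  - have := drop i; rewrite mi ig => /(_ isT).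
    have -> : 12 * c%:R * N.+1%:R ^+ 2 = (r1 c N).+1%:R :> R.
      by rewrite r1_succ 2!natrM natrX addn1.
    by move=> le; rewrite -ler_pdivlMr ?ltr0n // mul1r.
  - exact: lam_small.
have fM : (M <= f_tilde R D L k f m)%N by [].
have rec i : (m <= i < M)%N ->
    s x i.+1 <= (1 - lam i) * s x i + lam i * (2 * (k_bar k).+1%:R^-1) + err.
  move=> /andP[mi iM].
  have i1 : (m <= i.+1 < f_tilde2 R D L k f m)%N.
    by rewrite (leq_trans mi) //= /f_tilde2 addn2 ltnS ltnW // ltnS (leq_trans iM).
  have iPhi : (i <= Phi R c D l L k f N)%N.
    by apply: leq_trans gm; case/andP: i1 => _ /ltnW/ltnW.
  have ip_le := x_proj _ (exact_bounded i.+1)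
    (displacement_param_le _ _ (displacement _ i1)).
  have step := exact_step x i eps xp (x_fixed i iPhi).
  have h1 : 0 <= c%:R^-1 * `|y i - J (cs i) (y i)| ^+ 2.
    by rewrite mulr_ge0 ?sqr_ge0 ?(ltW c0).
  have h2 := ler_wpM2l (lam_ge0 i) ip_le.
  move: step h1 h2; rewrite -/err; set q := c%:R^-1; set q' := (k_bar k).+1%:R^-1; lra.
have D2 : 0 < D%:R ^+ 2 :> R by rewrite exprn_gt0 ?ltr0n.
have := tikhonov_rate lam_itv lam_div (s x) (fun _ => err) (2 * (k_bar k).+1%:R^-1)
  (4 * D%:R ^+ 2) m (12 * D ^ 2 * (k + 1)) m M (leqnSn m) _ _ _ _
  (sqr_dist_le _ _ xp) _ rec.
rewrite !muln_gt0 !D_gt0 addn1 => /(_ isT).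
have sM' : (L (m + ceil_ln R (12 * D ^ 2 * k.+1)) < M)%N.
  by move: sM; rewrite /sigma_bar !addn1.
move=> /(_ sM' (fun i _ => err0)).
rewrite mulr_ge0 ?(ltW D2) // mulr_ge0 ?invr_ge0 // => /(_ isT isT) /le_trans; apply.
have sum_err : \sum_(m <= i < M) err <= err * F.+1%:R.
  rewrite sumr_const_nat -[leLHS]mulr_natr ler_wpM2l // ler_nat.
  apply: leq_trans (leq_subr _ _) _; apply: leq_trans fM _.
  by apply: leqW; apply: f_tilde_leq.
have K0 : 1 <= k.+1%:R :> R by rewrite ler1n.
have B_eq : 4 * D%:R ^+ 2 / (12 * D ^ 2 * k.+1)%:R = 3^-1 * k.+1%:R^-1 :> R.
  rewrite 2!natrM natrX; field.
  by rewrite nat1r !pnatr_eq0 -!lt0n D_gt0.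
have sum_le : err * F.+1%:R <= 6^-1 * k.+1%:R^-1.
  rewrite -[leRHS]invfM -[leRHS]mul1r ler_pdivlMr; last lra.
  by move: err_r4; set FF := F.+1%:R; set KK := k.+1%:R; lra.
(* The three terms are at most 1/3, 1/2 and 1/6 of 1/(k+1). *)
have bar_le : 2 * (k_bar k).+1%:R^-1 <= 2^-1 * k.+1%:R^-1 :> R.
  rewrite k_barE; set KK := k.+1%:R in K0 *.
  have : KK^-1 * KK^-1 <= KK^-1 by rewrite ler_piMr ?invr_ge0 ?invf_le1 //; lra.
  have -> : (32 * KK ^+ 2)^-1 = 32^-1 * (KK^-1 * KK^-1) by rewrite invfM expr2 invfM.
  have : 0 <= KK^-1 by rewrite invr_ge0; lra.
  by set q := KK^-1; lra.
rewrite B_eq; move: sum_err sum_le bar_le.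
set q := k.+1%:R^-1; set q' := (k_bar k).+1%:R^-1; set S := \sum_(_ <= _ < _) _; lra.
Qed.

(** From l(X) on the lam_i are at most 1/(X+1), so the sum reached at [sigma_bar]
    forces more than X indices, and X >= n for the argument X of l in [r3]. *)
Lemma sigma_bar_ge n m : (r3 c D l k n <= m)%N -> (n <= sigma_bar R D L k m)%N.
Proof.
move=> rm.
set X := maxn (maxn (96 * c * D ^ 2 * (n + 1) ^ 2 - 1) (256 * D ^ 2 * (k + 1) ^ 2 - 1))
  (16 * c * r2 D k n ^ 2 * D ^ 2).
have nX : (n <= X)%N.
  have : (n < 96 * c * D ^ 2 * (n + 1) ^ 2)%N.
    apply: (@leq_trans ((n + 1) ^ 2)); first by nia.
    by rewrite leq_pmull // !muln_gt0 c_gt0 !D_gt0.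
  by rewrite /X; set Y := (96 * _ * _ * _)%N; lia.
have q_gt0 : (0 < 12 * D ^ 2 * (k + 1))%N by rewrite !muln_gt0 !D_gt0 addn1.
have ln_gt0 : (0 < ceil_ln R (12 * D ^ 2 * (k + 1)))%N.
  rewrite lt0n; apply/eqP => ln0; have := expR_ceil_ln (12 * D ^ 2 * (k + 1)) q_gt0 (R := R).
  rewrite ln0 oppr0 expR0 invf_ge1 ?ltr0n // lern1.
  apply/negP; rewrite -ltnNge -mulnA; apply: (@leq_trans 12) => //.
  by rewrite leq_pmulr // !muln_gt0 !D_gt0 addn1.
have Ln : (L (m + ceil_ln R (12 * D ^ 2 * (k + 1))) < sigma_bar R D L k m)%N.
  by rewrite /sigma_bar; lia.
have sum_ge := sum_divergence lam_itv lam_div m (ceil_ln R (12 * D ^ 2 * (k + 1))) (r3 c D l k n)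
  (sigma_bar R D L k m) (leq_trans rm (leqnSn m)) Ln.
have sum_le : \sum_(r3 c D l k n <= i < sigma_bar R D L k m) lam i <=
    (sigma_bar R D L k m)%:R * X.+1%:R^-1.
  apply: (@le_trans _ _ (\sum_(r3 c D l k n <= i < sigma_bar R D L k m) X.+1%:R^-1)).
    rewrite big_nat_cond [leRHS]big_nat_cond; apply: ler_sum => i.
    by rewrite andbT => /andP[ri _]; apply: lam_le.
  by rewrite sumr_const_nat -[leLHS]mulr_natl ler_wpM2r ?invr_ge0 // ler_nat leq_subr.
have : 1 <= (sigma_bar R D L k m)%:R * X.+1%:R^-1 :> R.
  by apply: le_trans sum_le; apply: le_trans sum_ge; rewrite ler1n.
rewrite ler_pdivlMr ?ltr0n // mul1r ler_nat => /ltnW; exact: leq_trans.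
Qed.

(** [Xi2] evaluates [r2] at Phi(n) although the estimates need it at n. If the
    interval from Phi(n) to f(Phi(n)) is nonempty, then f(sigma_bar) < f(Phi(n)),
    hence sigma_bar < Phi(n) by monotonicity of f, and [sigma_bar_ge] applies. *)
Lemma Phi_ge n : (Phi R c D l L k f n <= f (Phi R c D l L k f n))%N ->
  (n <= Phi R c D l L k f n)%N.
Proof.
set m := phi2 D (r1 c n) (r3 c D l k n) (f_tilde2 R D L k f) => le_f.
have /leq_trans : (n <= sigma_bar R D L k m)%N by apply: sigma_bar_ge; rewrite leq_maxl.
apply; rewrite leqNgt; apply/negP => /ltnW /(nat_monotone_leq f _ _ f_mono) f_le.
have : (f (sigma_bar R D L k m) + 2 <= f (sigma_bar R D L k m))%N.
  exact: leq_trans f_le.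
by rewrite addn2 ltnNge leqnSn.
Qed.

(** For i in the interval let m be the last index before i at which the squared
    distance increases; m is at least r3(N), so lam_m is small. The increase makes
    y_m almost fixed ([increase_displacement]), and [increase_small] bounds the
    squared distance at m + 1, which dominates the one at i. *)
Lemma exact_metastable_increasing :
  (exists2 i, (r3 c D l k N <= i < Phi R c D l L k f N)%N & s x i < s x i.+1) ->
  forall i, (Phi R c D l L k f N <= i <= f (Phi R c D l L k f N))%N ->
    s x i <= k.+1%:R^-1.
Proof.
move=> [i0 /andP[ri0 i0Phi] s_i0] M /andP[PhiM Mf].
have [m [/andP[im mM] s_m s_M]] := last_increase (s x) _ _ (leq_trans i0Phi PhiM) s_i0.
apply: le_trans s_M _; have rm := leq_trans ri0 im.
have mf : (m <= f (Phi R c D l L k f N))%N by rewrite ltnW // (leq_trans mM).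
set hf := h (f (Phi R c D l L k f N)).
set rr := r2 D k N.
set jj := maxn (16 * hf * (k + 1) ^ 2 * (6 * D + 1))
  (4 * c * r2 D k (Phi R c D l L k f N) ^ 2 * (6 * D + 1)).
have rr_le : (rr <= r2 D k (Phi R c D l L k f N))%N.
  by apply: r2_leq; apply: Phi_ge; apply: leq_trans Mf.
pose eps : R := jj.+1%:R^-1.
have x_fixed : `|x - J (cs m) x| <= eps.
  by apply: zeta_almost_fixed xJ _ mf; rewrite /Xi leq_max; apply/orP; right.
pose err := 6 * D%:R * eps.
have err0 : 0 <= err by apply: mulr_ge0; [apply: mulr_ge0|rewrite invr_ge0].
have err_le q : (q * (6 * D + 1) <= jj)%N -> err * q%:R <= 1.
  move=> qm; apply: (@error_le _ jj) => //.
  have -> : (6 * D%:R + 1) * q%:R = (q * (6 * D + 1))%:R :> R.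
    by rewrite !natrM natrD natrM; ring.
  by rewrite ler_nat leqW.
have err_h : err * (16 * hf%:R * k.+1%:R ^+ 2) <= 1.
  have -> : 16 * hf%:R * k.+1%:R ^+ 2 = (16 * hf * (k + 1) ^ 2)%:R :> R.
    by rewrite 2!natrM natrX addn1.
  by apply: err_le; rewrite leq_maxl.
have err_r : err * (4 * c%:R * rr%:R ^+ 2) <= 1.
  have -> : 4 * c%:R * rr%:R ^+ 2 = (4 * c * rr ^ 2)%:R :> R.
    by rewrite 2!natrM natrX.
  apply: err_le; rewrite leq_max; apply/orP; right.
  by rewrite leq_mul2r leq_mul2l leq_exp2r // rr_le !orbT.
have lam_r : lam m * (16 * c%:R * rr%:R ^+ 2 * D%:R ^+ 2) <= 1.
  have -> : 16 * c%:R * rr%:R ^+ 2 * D%:R ^+ 2 = (16 * c * rr ^ 2 * D ^ 2)%:R :> R.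
    by rewrite 3!natrM 2!natrX.
  by apply: (lam_scale_le _ _ _ rm); rewrite leqW // leq_maxr.
have lam_k : lam m * (256 * D%:R ^+ 2 * k.+1%:R ^+ 2) <= 1.
  have -> : 256 * D%:R ^+ 2 * k.+1%:R ^+ 2 = (256 * D ^ 2 * (k + 1) ^ 2)%:R :> R.
    by rewrite 2!natrM 2!natrX addn1.
  by apply: (lam_scale_pred_le _ _ _ rm); rewrite !leq_max leqnn orbT.
have rrN : (2 * (N + 1) <= rr)%N by rewrite leq_maxl.
have rrk : (128 * D * (k + 1) ^ 2 <= rr)%N by rewrite leq_maxr.
have rr_gt0 : (0 < rr)%N by apply: leq_trans rrN; rewrite muln_gt0 addn1.
have step := exact_step x m eps xp x_fixed; rewrite -/err in step.
have l_gt0 : 0 < lam m by case/andP: (lam_itv m).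
have t_le : `|y m - J (cs m) (y m)| <= rr%:R^-1.
  apply: (@increase_displacement _ c%:R D%:R _ _ (lam m)
    (2 * ip (u - x) (y m.+1 - x)) err) => //; rewrite ?ler1n //.
    exact: anchor_ip_le.
  have : 0 <= lam m * s x m by rewrite mulr_ge0 ?sqr_ge0.
  by move: step s_m; set q := c%:R^-1; lra.
have t_N : `|y m - J (cs m) (y m)| <= N.+1%:R^-1.
  apply: le_trans t_le _; rewrite lef_pV2 ?posrE ?ltr0n // ler_nat.
  by apply: leq_trans rrN; rewrite addn1 leq_pmull.
have ip_m := x_proj _ (exact_bounded m) (displacement_param_le _ _ t_N).
rewrite -[leRHS]mul1r ler_pdivlMr ?ltr0n //.
apply: (@increase_small _ D%:R _ `|y m - J (cs m) (y m)| (lam m) hf%:R _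
  (ip (u - x) (y m - x)) (ip (u - x) (y m.+1 - x)) err) => //; rewrite ?ler1n //.
- by rewrite -ler_pdivlMr ?mulr_gt0 ?exprn_gt0 ?ltr0n // mul1r -k_barE.
- have -> : ip (u - x) (y m.+1 - x) = ip (u - x) (y m - x) + ip (u - x) (y m.+1 - y m).
    by rewrite !ipE; ring.
  rewrite lerD2l; apply: le_trans (ip_le_norm ip_norm _ _) _.
  apply: ler_pM => //; first exact: anchor_dist.
  rewrite y_S; exact: (tikhonov_move ip_norm up _ _ _ _ _ (lam_ge0 m) (del_ge0 m) (del_le1 m)
    (sum_eq1 m) (exact_bounded m)).
- apply: (@le_trans _ _ (rr%:R^-1 * rr%:R)); last by rewrite mulVf // pnatr_eq0 -lt0n.
  apply: ler_pM => //.
  by move: rrk; rewrite -(ler_nat R) 2!natrM natrX addn1.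
- have : (1 - lam m) * s x m <= (1 - lam m) * s x m.+1.
    by rewrite ler_wpM2l ?subr_ge0 // ltW.
  have : 0 <= c%:R^-1 * `|y m - J (cs m) (y m)| ^+ 2.
    by rewrite mulr_ge0 ?sqr_ge0 ?(ltW c0).
  by move: step; set q := c%:R^-1; lra.
- rewrite -ler_pdivrMl ?ltr0n ?h_gt0 // mulr1.
  apply: le_trans (lam_ge m); rewrite lef_pV2 ?posrE ?ltr0n ?h_gt0 //.
  by rewrite ler_nat nat_monotone_leq.
Qed.

End Index.

(** The approximate projection is taken at precision 1/(32(k+1)^2), and is itself
    fixed to within 1/(Xi(N)+1), where N is the level at which it is a projection. *)
Lemma exact_metastable k f : nat_monotone f ->
  exists2 n, (n <= mu R c D C h l L k f)%N &
    exists x, forall i, (n <= i <= f n)%N -> s x i <= k.+1%:R^-1.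
Proof.
move=> f_mono.
have T_ne (v w : H) := resolvent_nonexpansive ip_norm A_mono J_res c%:R^-1 v w c0.
have [N [x [N_le xp xJ x_proj]]] := approximate_projection ip_norm (J c%:R^-1) u p D
  (k_bar k) (Xi R c D C h l L k f) T_ne (resolvent_zero J_res _ _ c0 Ap) D_gt0 up.
have [inc|/forallPNP no_inc] := pselect (exists2 i,
    (r3 c D l k N <= i < Phi R c D l L k f N)%N & s x i < s x i.+1).
  exists (Phi R c D l L k f N).
    by rewrite leq_max Phi_leq ?orbT.
  by exists x; exact: exact_metastable_increasing xJ x_proj inc.
have dec i : (r3 c D l k N <= i < Phi R c D l L k f N)%N -> s x i.+1 <= s x i.
  by move=> iP; rewrite leNgt; apply/negP; exact: no_inc.
have [m m_le m_ok] := exact_metastable_decreasing f_mono xp xJ x_proj dec.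
exists (sigma_bar R D L k m); last by exists x.
rewrite leq_max sigma_bar_mono // (leq_trans m_le) //.
exact: phi2_leq.
Qed.

End ExactIteration.

(** * Effect of the errors *)

Section Perturbation.
Context {R : realType} {lam : nat -> R} {L E : nat -> nat}.
Hypothesis lam_itv : forall n, 0 < lam n < 1.
Hypothesis lam_div : forall k, k%:R <= \sum_(1 <= i < (L k).+1) lam i.
Context {w er : nat -> R}.
Hypothesis w_0 : w 0%N = 0.
Hypothesis w_S : forall n, w n.+1 <= (1 - lam n) * w n + er n.
Hypothesis er_ge0 : forall n, 0 <= er n.
Hypothesis er_small : (forall k n,
    \sum_((E k).+1 <= i < (E k + n).+1) er i <= k.+1%:R^-1) \/
  (forall k n, (E k <= n)%N -> er n / lam n <= k.+1%:R^-1).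
Context {d0 d1 d2 : nat}.
Hypothesis d1_bound : (\sum_(0 <= i < (E 0%N).+1) er i) + 1 <= d1%:R.
Hypothesis d2_bound : forall i, (i <= E 0%N)%N -> w i <= d2%:R.
Hypothesis d2_gt0 : (0 < d2)%N.

Let dd : R := (d d0 d1 d2)%:R.
Let lam_ge0 i : 0 <= lam i. Proof. by case/andP: (lam_itv i) => /ltW. Qed.
Let lam_le1 i : lam i <= 1. Proof. by case/andP: (lam_itv i) => _ /ltW. Qed.
Let d_ge0 : 0 <= dd. Proof. exact: ler0n. Qed.
Let d1_le : d1%:R <= dd.
Proof. by rewrite ler_nat /d leq_max leq_addl. Qed.
Let d2_le : d2%:R <= dd.
Proof. by rewrite ler_nat /d leq_maxr. Qed.

(** By induction w_n is at most the sum of the errors before n; those after E(0)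
    add up to at most 1, which is the extra 1 in the bound on d1. *)
Lemma perturbation_summable_bounded : (forall k n,
    \sum_((E k).+1 <= i < (E k + n).+1) er i <= k.+1%:R^-1) ->
  forall n, w n <= dd.
Proof.
move=> er_sum n; have w_sum m : w m <= \sum_(0 <= i < m) er i.
  elim: m => [|m IHm]; first by rewrite w_0 big_geq.
  rewrite big_nat_recr //=; apply: le_trans (w_S m) _; rewrite lerD2r.
  apply: (@le_trans _ _ ((1 - lam m) * \sum_(0 <= i < m) er i)).
    by rewrite ler_wpM2l ?subr_ge0.
  by rewrite ler_piMl ?sumr_ge0 // lerBlDr lerDl.
apply: le_trans (w_sum n) _; apply: le_trans d1_le; apply: le_trans d1_bound.
apply: (@le_trans _ _ (\sum_(0 <= i < (E 0 + n).+1) er i)).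
  rewrite [leRHS](@big_cat_nat _ _ _ n) //=; first by rewrite lerDl sumr_ge0.
  by rewrite leqW ?leq_addl.
rewrite [leLHS](@big_cat_nat _ _ _ (E 0).+1) //=; last by rewrite ltnS leq_addr.
rewrite lerD2l; apply: le_trans (er_sum 0%N n) _.
by rewrite invr1.
Qed.

(** After E(0) the error is at most lam_n, so w_(n+1) is bounded by a convex
    combination of w_n and 1. *)
Lemma perturbation_relative_bounded :
  (forall k n, (E k <= n)%N -> er n / lam n <= k.+1%:R^-1) ->
  forall n, w n <= dd.
Proof.
move=> er_rel; elim=> [|n IHn]; first by rewrite w_0.
case: (ltnP n (E 0%N)) => [nE|En].
  by apply: le_trans d2_le; exact: d2_bound.
have er_le : er n <= lam n.
  have := er_rel _ _ En; rewrite invr1 ler_pdivrMr ?mul1r //.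
  by case/andP: (lam_itv n).
have d1' : 1 <= dd by apply: le_trans d2_le; rewrite ler1n.
apply: le_trans (w_S n) _; have := lam_ge0 n; have := lam_le1 n; nra.
Qed.

(** Both kinds of errors fit [tikhonov_rate] from E(3j+2) + 1 on: summable ones as
    the v_i, relative ones as the average a. Either contributes 1/(3(j+1)), and the
    factor 3d(j+1) inside the logarithm reduces the initial bound d to 1/(3(j+1)). *)
Lemma perturbation_rate j n : (Theta R L E d0 d1 d2 j <= n)%N ->
  w n <= j.+1%:R^-1.
Proof.
rewrite /Theta !addn1 => Tn.
set m := E (3 * j + 2) in Tn *.
have d_gt0 : (0 < d d0 d1 d2)%N by rewrite /d leq_max d2_gt0 orbT.
have q_gt0 : (0 < 3 * d d0 d1 d2 * j.+1)%N by rewrite !muln_gt0 d_gt0.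
have idx : (3 * j + 2).+1%:R^-1 = 3^-1 * j.+1%:R^-1 :> R.
  by rewrite -invfM -natrM; congr (_%:R^-1); lia.
have q_eq : dd / (3 * d d0 d1 d2 * j.+1)%:R = 3^-1 * j.+1%:R^-1 :> R.
  by rewrite /dd 2!natrM; field; rewrite nat1r !pnatr_eq0 -!lt0n d_gt0.
have q_ge0 : 0 <= j.+1%:R^-1 :> R by rewrite invr_ge0.
have mn : (m.+1 <= n)%N.
  apply: leq_trans Tn; rewrite ltnS.
  by apply: leq_trans (divergence_rate_ge lam_itv lam_div _); rewrite leq_addr.
case: er_small => [er_sum|er_rel].
- have := tikhonov_rate lam_itv lam_div w er 0 dd m _ m.+1 n (leqnn _) q_gt0 Tn
    (fun i _ => er_ge0 i) d_ge0 (perturbation_summable_bounded er_sum _) (lexx _).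
  have rec i : (m < i < n)%N -> w i.+1 <= (1 - lam i) * w i + lam i * 0 + er i.
    by rewrite mulr0 addr0.
  move=> /(_ rec) /le_trans; apply.
  have := er_sum (3 * j + 2)%N (n - m.+1)%N; rewrite -/m -addSn subnKC // idx q_eq.
  by move: q_ge0; set q := j.+1%:R^-1; set S := \sum_(_ <= _ < _) _; lra.
- have := tikhonov_rate lam_itv lam_div w (fun _ => 0) (3 * j + 2).+1%:R^-1 dd m _ m.+1 n
    (leqnn _) q_gt0 Tn (fun i _ => lexx _) d_ge0 (perturbation_relative_bounded er_rel _) _.
  have rec i : (m < i < n)%N ->
      w i.+1 <= (1 - lam i) * w i + lam i * (3 * j + 2).+1%:R^-1 + 0.
    move=> /andP[mi _]; rewrite addr0; apply: le_trans (w_S i) _; rewrite lerD2l.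
    have := er_rel _ _ (ltnW mi); rewrite ler_pdivrMr 1?mulrC //.
    by case/andP: (lam_itv i).
  rewrite invr_ge0 ler0n => /(_ isT rec) /le_trans; apply.
  rewrite big1 // idx q_eq.
  by move: q_ge0; set q := j.+1%:R^-1; lra.
Qed.

End Perturbation.

Theorem corollary3p10
  (R : realType) (H : completeNormedModType R) (ip : {dot H for @idfun R})
  (ip_norm : induces_norm ip)
  (A : H -> set H) (A_maximal : maximal_monotone ip A)
  (zeros_nonempty : zeros A !=set0)
  (J : R -> H -> H) (J_resolvent : is_resolvent A J)
  (u z0 : H) (e : nat -> H) (cs lam del gam : nat -> R)
  (cs_gt0 : forall n, 0 < cs n)
  (lam_itv : forall n, 0 < lam n < 1)
  (del_itv : forall n, 0 < del n < 1)
  (gam_itv : forall n, 0 <= gam n < 1)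
  (sum_eq1 : forall n, lam n + gam n + del n = 1)
  (z y : nat -> H)
  (z_0 : z 0%N = z0)
  (z_S : forall n, z n.+1 =
     lam n *: u + gam n *: z n + del n *: J (cs n) (z n) + e n)
  (y_0 : y 0%N = z0)
  (y_S : forall n, y n.+1 =
     lam n *: u + gam n *: y n + del n *: J (cs n) (y n))
  (c : nat) (c_gt0 : (0 < c)%N)
  (h l L E : nat -> nat)
  (h_gt0 : forall n, (0 < h n)%N)
  (h_mono : nat_monotone h) (l_mono : nat_monotone l)
  (L_mono : nat_monotone L) (E_mono : nat_monotone E)
  (H1 : forall n, (h n)%:R^-1 <= lam n)
  (H2 : forall k n, (l k <= n)%N -> lam n <= k.+1%:R^-1)
  (H3 : forall k, k%:R <= \sum_(1 <= i < (L k).+1) lam i)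
  (H4 : forall n, c%:R^-1 <= Num.min (cs n) (del n ^+ 2))
  (H5 : (forall k n,
           \sum_((E k).+1 <= i < (E k + n).+1) `|e i| <= k.+1%:R^-1) \/
        (forall k n, (E k <= n)%N -> `|e n| / lam n <= k.+1%:R^-1))
  (D : nat) (D_gt0 : (0 < D)%N)
  (D_bound : exists2 p, zeros A p &
     Num.max (2 * `|u - p|) `|z0 - p| <= D%:R)
  (C : nat -> nat) (C_mono : nat_monotone C)
  (C_bound : forall n, cs n <= (C n)%:R)
  (d0 d1 d2 : nat)
  (d0_gt0 : (0 < d0)%N) (d1_gt0 : (0 < d1)%N) (d2_gt0 : (0 < d2)%N)
  (d0_bound : exists2 q, zeros A q &
     Num.max `|u - q| `|z0 - q| <= d0%:R)
  (d1_bound : (\sum_(0 <= i < (E 0%N).+1) `|e i|) + 1 <= d1%:R)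
  (d2_bound : forall i, (i <= E 0%N)%N -> `|z i - y i| <= d2%:R)
  (k : nat) (f : nat -> nat) (f_mono : nat_monotone f) :
  exists2 n, (n <= nu R c D C h l L E d0 d1 d2 k f)%N &
    forall i j, (n <= i <= f n)%N -> (n <= j <= f n)%N ->
      `|z i - z j| <= k.+1%:R^-1.
Proof.
have A_mono : monotone_op ip A by case: A_maximal.
have [p Ap] := D_bound; rewrite ge_max => /andP[up z0p].
have lam_ge0 i : 0 <= lam i by case/andP: (lam_itv i) => /ltW.
have del_ge0 i : 0 <= del i by case/andP: (del_itv i) => /ltW.
have gam_ge0 i : 0 <= gam i by case/andP: (gam_itv i).
have y0p : `|y 0%N - p| <= D%:R by rewrite y_0.
pose w i := `|z i - y i|.
have w_0 : w 0%N = 0 by rewrite /w z_0 y_0 subrr normr0.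
have w_S i : w i.+1 <= (1 - lam i) * w i + `|e i|.
  have -> : 1 - lam i = gam i + del i by rewrite -(sum_eq1 i); ring.
  rewrite /w z_S y_S.
  have -> : lam i *: u + gam i *: z i + del i *: J (cs i) (z i) + e i -
      (lam i *: u + gam i *: y i + del i *: J (cs i) (y i)) =
      gam i *: (z i - y i) + del i *: (J (cs i) (z i) - J (cs i) (y i)) + e i.
    by vector_ring.
  apply: le_trans (ler_normD _ _) _; rewrite lerD2r mulrDl.
  apply: le_trans (ler_normD _ _) _; rewrite !normrZ !ger0_norm // lerD2l.
  by rewrite ler_wpM2l // (resolvent_nonexpansive ip_norm A_mono J_resolvent).
have zy j n := perturbation_rate lam_itv H3 w_0 w_S (fun i => normr_ge0 (e i)) H5
  d1_bound d2_bound d2_gt0 (d0 := d0) j n.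
set T := Theta R L E d0 d1 d2 (3 * k + 2).
have fhat_mono : nat_monotone (f_hat R L E d0 d1 d2 k f).
  by move=> n; rewrite /f_hat; apply: nat_monotone_leq => //; lia.
have [n0 n0_le [x x_near]] := exact_metastable ip_norm A_mono J_resolvent lam_itv del_itv
  gam_ge0 sum_eq1 y_S c_gt0 h_gt0 h_mono l_mono L_mono H1 H2 H3 H4 D_gt0 Ap up y0p
  C_mono C_bound (36 * (k + 1) ^ 2 - 1) _ fhat_mono.
exists (maxn n0 T).
  rewrite geq_max /nu; apply/andP; split; last by rewrite leq_maxr.
  by apply: leq_trans n0_le _; rewrite leq_maxl.
have K_gt0 : 0 < k.+1%:R :> R by rewrite ltr0n.
(* |z_i - y_i| <= 1/(3(k+1)) and |y_i - x| <= 1/(6(k+1)), the latter since the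
   precision 36(k+1)^2 is asked of the squared distance. *)
have z_near i : (maxn n0 T <= i <= f (maxn n0 T))%N -> `|z i - x| <= 2^-1 * k.+1%:R^-1.
  rewrite geq_max => /andP[/andP[n0i Ti] i_f].
  have zy_i := zy _ _ Ti.
  have y_x : `|y i - x| <= 6^-1 * k.+1%:R^-1.
    have := x_near i; rewrite /sqr_dist n0i i_f => /(_ isT).
    have -> : (36 * (k + 1) ^ 2 - 1).+1%:R^-1 = (6^-1 * k.+1%:R^-1) ^+ 2 :> R.
      rewrite subn1 prednK ?muln_gt0 ?addn1 // natrM natrX -invfM exprVn exprMn.
      by congr (_^-1); ring.
    by rewrite ler_pXn2r ?nnegrE ?mulr_ge0 ?invr_ge0.
  have idx : (3 * k + 2).+1%:R^-1 = 3^-1 * k.+1%:R^-1 :> R.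
    by rewrite -invfM -natrM; congr (_%:R^-1); lia.
  have -> : z i - x = (z i - y i) + (y i - x) by rewrite addrA subrK.
  apply: le_trans (ler_normD _ _) _; move: zy_i y_x; rewrite idx /w.
  by set q := k.+1%:R^-1; lra.
move=> i j /z_near iz /z_near jz.
have -> : z i - z j = (z i - x) - (z j - x) by rewrite opprB addrA subrK.
apply: le_trans (ler_normB _ _) _; move: iz jz.
by set q := k.+1%:R^-1; lra.
Qed.
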